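(* For $\alpha\in(0,1]$ let $m(\alpha):=\rho_{\mathrm{DB}}(\Gamma_\alpha)=\inf\{\rho_{\mathrm{DB}}(A,B):(A,B)\in\gamma_\alpha\}$ be the minimal $\ell^1$ double bubble perimeter (defined in the context). There are two critical values of $\alpha$ at which $m$ undergoes a phase transition: at $\alpha=\frac{688-480\sqrt{2}}{49}$ the first order derivative of $m$ is discontinuous, and at $\alpha=\frac12$ the second order derivative of $m$ is discontinuous.
   Context: Discontinuity of the $k$-th order derivative at a point means that the $k$-th derivative of $m$, defined on both sides of the point, has different left and right limits there. $\mu$ is Lebesgue measure on $\mathbb{R}^2$. For a simple curve $\lambda:[a,b]\to\mathbb{R}^2$ (not necessarily closed), $\lambda(t)=(x(t),y(t))$, its $\ell^1$ length is $$\rho(\lambda)=\sup_{N\ge 1}\ \sup_{a\le t_1\le\dots\le t_N\le b}\ \sum_{i=1}^{N-1}\big(|x(t_{i+1})-x(t_i)|+|y(t_{i+1})-y(t_i)|\big).$$ Curves are parametrized on $[0,1]$. Two curves $\lambda,\lambda'$ intersect nontrivially if there are (nondegenerate) intervals $[s,s'],[t,t']\subset[0,1]$ with $\lambda([s,s'])=\lambda'([t,t'])$. Their nontrivial intersection is then written as a union of non-overlapping curves $\lambda_i$, each with image $\lambda([s_i,s_{i+1}])$ for an interval $[s_i,s_{i+1}]$, and $\rho(\lambda\cap\lambda'):=\sum_i\rho(\lambda_i)$ (equal to $0$ if there is no nontrivial intersection). For $\alpha\in(0,1]$, $\gamma_\alpha$ is the set of ordered pairs $(A,B)$ of disjoint,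 simply connected open subsets of $\mathbb{R}^2$ such that $\partial A$ and $\partial B$ are closed, continuous, simple, rectifiable curves, $\partial A\cap\partial B$ is a (possibly empty) union of disjoint rectifiable curves, $\mu(A)=1$ and $\mu(B)=\alpha$. For such a pair with $\partial A=\lambda([0,1])$ and $\partial B=\lambda'([0,1])$, the double bubble perimeter is $\rho_{\mathrm{DB}}(A,B)=\rho(\lambda)+\rho(\lambda')-\rho(\lambda\cap\lambda')$. *)

(* Defs.v *)
From HB Require Import structures.
From mathcomp Require Import all_boot all_order all_algebra.
From mathcomp Require Import all_classical all_reals all_analysis.

Set Implicit Arguments.
Unset Strict Implicit.
Unset Printing Implicit Defensive.

Import Order.TTheory GRing.Theory Num.Theory.
Import numFieldNormedType.Exports.

Local Open Scope classical_set_scope.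
Local Open Scope ring_scope.

Definition mu2 (R : realType) (A : set (R * R)) : \bar R :=
  ((@lebesgue_measure R) \x (@lebesgue_measure R))%E A.

Definition topboundary (T : topologicalType) (A : set T) : set T :=
  closure A `\` interior A.

Definition l1dist (R : realType) (p q : R * R) : R :=
  `|q.1 - p.1| + `|q.2 - p.2|.

(* The l^1 length of l restricted to [a, b]; the subdivision points are
   indexed from 0, i.e. t 0 <= ... <= t N.-1. *)
Definition rho (R : realType) (a b : R) (l : R -> R * R) : \bar R :=
  ereal_sup [set v | exists (N : nat) (t : nat -> R),
    [/\ (0 < N)%N,
        forall i, (i < N)%N -> a <= t i <= b,
        forall i, (i.+1 < N)%N -> t i <= t i.+1 &
        v = (\sum_(0 <= i < N.-1) l1dist (l (t i)) (l (t i.+1)))%:E]].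

(* Curves are functions on R of which only the values on [0, 1] matter. *)
Definition curve (R : realType) (l : R -> R * R) : Prop :=
  {within `[0, 1], continuous l}.

Definition rectifiable (R : realType) (l : R -> R * R) : Prop :=
  (rho 0 1 l < +oo)%E.

Definition simple_closed (R : realType) (l : R -> R * R) : Prop :=
  l 0 = l 1 /\
  forall s t, 0 <= s < 1 -> 0 <= t < 1 -> l s = l t -> s = t.

(* l is a closed, continuous, simple, rectifiable parametrization of the
   boundary of A. *)
Definition boundary_curve (R : realType) (A : set (R * R)) (l : R -> R * R) :
    Prop :=
  [/\ curve l, simple_closed l, rectifiable l & topboundary A = l @` `[0, 1]].

Definition path_connected (R : realType) (A : set (R * R)) : Prop :=
  forall p q, A p -> A q -> exists l : R -> R * R,
    [/\ curve l, l @` `[0, 1] `<=` A, l 0 = p & l 1 = q].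

(* Every loop in A is homotopic in A, relative to its base point, to a
   constant loop; the second coordinate is the time of the homotopy. *)
Definition simply_connected (R : realType) (A : set (R * R)) : Prop :=
  path_connected A /\
  forall l : R -> R * R, curve l -> l @` `[0, 1] `<=` A -> l 0 = l 1 ->
    exists H : R * R -> R * R,
      [/\ {within `[0, 1] `*` `[0, 1], continuous H},
          H @` (`[0, 1] `*` `[0, 1]) `<=` A,
          forall s, 0 <= s <= 1 -> H (s, 0) = l s /\ H (s, 1) = l 0 &
          forall t, 0 <= t <= 1 -> H (0, t) = l 0 /\ H (1, t) = l 0].

(* The family of curves is countable (indexed by D, possibly empty): an
   arbitrary family would make the condition void, every set being the union
   of its points. Constant curves are allowed, so that two boundaries may touch
   at a point. *)
Definition union_disjoint_curves (R : realType) (X : set (R * R)) : Prop :=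
  exists (D : set nat) (c : nat -> R -> R * R),
    [/\ forall i, D i -> curve (c i) /\ rectifiable (c i),
        trivIset D (fun i => c i @` `[0, 1]) &
        X = \bigcup_(i in D) (c i @` `[0, 1])].

Definition gamma (R : realType) (alpha : R) (A B : set (R * R)) : Prop :=
  [/\ A `&` B = set0,
      [/\ open A, simply_connected A & exists l, boundary_curve A l],
      [/\ open B, simply_connected B & exists l, boundary_curve B l],
      union_disjoint_curves (topboundary A `&` topboundary B) &
      mu2 A = 1%E /\ mu2 B = alpha%:E].

Definition common_arc (R : realType) (l l' : R -> R * R) (s s' : R) : Prop :=
  [/\ 0 <= s, s < s', s' <= 1 &
      exists t t', [/\ 0 <= t, t < t', t' <= 1 &
                       l @` `[s, s'] = l' @` `[t, t']]].

Definition nontrivial_intersection (R : realType) (l l' : R -> R * R) :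
    set (R * R) :=
  \bigcup_(p in [set p : R * R | common_arc l l' p.1 p.2]) (l @` `[p.1, p.2]).

(* The nontrivial intersection as a countable union of the non-overlapping
   curves l([s i, s' i]), i in D (so D is empty when there is no nontrivial
   intersection). *)
Definition arc_decomposition (R : realType) (l l' : R -> R * R)
    (D : set nat) (s s' : nat -> R) : Prop :=
  [/\ forall i, D i -> [/\ 0 <= s i, s i < s' i & s' i <= 1],
      trivIset D (fun i => [set` `]s i, s' i[]) &
      \bigcup_(i in D) (l @` `[s i, s' i]) = nontrivial_intersection l l'].

(* v is the value of rho(l cap l'); it does not depend on the decomposition. *)
Definition is_rho_cap (R : realType) (l l' : R -> R * R) (v : \bar R) : Prop :=
  exists (D : set nat) (s s' : nat -> R),
    arc_decomposition l l' D s s' /\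
    v = \esum_(i in D) rho (s i) (s' i) l.

(* v is the double bubble perimeter of (A, B); it does not depend on the
   parametrizations of the boundaries. *)
Definition is_rhoDB (R : realType) (A B : set (R * R)) (v : R) : Prop :=
  exists (l l' : R -> R * R) (c : \bar R),
    [/\ boundary_curve A l, boundary_curve B l', is_rho_cap l l' c &
        v%:E = (rho 0 1 l + rho 0 1 l' - c)%E].

Definition minDB (R : realType) (alpha : R) : R :=
  inf [set v | exists A B, gamma alpha A B /\ is_rhoDB A B v].

(* The k-th derivative of f exists on both sides of a and has different finite
   one-sided limits at a; derive1n is a total operator, hence the explicit
   existence of the successive derivatives near a. *)
Definition deriv_jump (R : realType) (f : R -> R) (k : nat) (a : R) : Prop :=
  (\forall x \near a^', forall j, (j < k)%N -> derivable (derive1n j f) x 1) /\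
  exists y z : R, [/\ derive1n k f x @[x --> a^'-] --> y,
                      derive1n k f x @[x --> a^'+] --> z & y <> z].

Definition phase_transition (R : realType) (f : R -> R) (a : R) : Prop :=
  exists k, (0 < k)%N /\ deriv_jump f k a.

(* Main.v *)
Require Import Defs.
From mathcomp Require Import all_boot all_order all_algebra.
From mathcomp Require Import all_classical all_reals all_analysis.
From mathcomp Require finmap.
From mathcomp Require Import measurable_realfun.
From mathcomp Require Import ring lra zify.

Set Implicit Arguments.
Unset Strict Implicit.
Unset Printing Implicit Defensive.

Import Order.TTheory GRing.Theory Num.Theory.
Import numFieldNormedType.Exports.

Local Open Scope classical_set_scope.
Local Open Scope ring_scope.

(** For 0 < al < 1 the minimal perimeter is computed exactly. Three families of
    rectangular configurations compete:
    - the small set is a square in a corner of a large square of area 1 + al,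
      with total length 4 sqrt (1 + al) + 2 sqrt al ([corner_perim]);
    - a rectangle of height half its width stands on a side of a unit square,
      with total length 4 + 2 sqrt (2 al) ([side_perim]);
    - two rectangles of the same width are stacked, with total length
      2 sqrt (6 (1 + al)) ([stack_perim]).
    The first wins up to al = (688 - 480 sqrt 2) / 49, the second from there to
    1 / 2, and the third afterwards ([minDBE]). The graphs of the first two
    expressions cross transversally, whence a jump of the first derivative;
    the last two touch at 1 / 2 with the same slope 2 and different second
    derivatives. Between the critical points the minimum is a smooth
    combination of 1, sqrt x and sqrt (1 + x), so no derivative jumps there.

    Lower bound. The l^1 length of a curve is at least the integral over u of
    the number of its points on the vertical line x = u plus the number of its
    points on the horizontal line y = u ([banach_indicatrix]). A line that meets
    only one of the two regions meets the boundaries at least twice, and a line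
    that meets both meets them at least three times ([line_count]). Hence the
    perimeter is at least the sum of the half perimeters (width plus height) of
    the shadows of A, of B and of A `|` B ([half_perimeters_le_rhoDB]). The
    common arcs are subtracted only once: finitely many of them are cut out of
    the first boundary ([complementary_gaps]), and what is left of it, together
    with the whole second boundary, still covers both boundaries.
    If A has width a and height b, B has width c and height d, and the shadows
    overlap in lengths e and f, this is the bound 2 (a + b + c + d) - e - f,
    while comparing areas of products of shadows gives a b >= 1, c d >= al and
    a b + c d - e f >= 1 + al. Only this six-variable problem remains
    ([two_boxes_min_perim]). With e + f fixed, e f is least at the ends of the
    admissible range, so one may assume that one pair of shadows is nested, say
    the vertical ones; then, for fixed heights, the bound is affine in the excess
    area of the taller box, and the competitors are found at the two ends.

    Upper bound. One family of pairs contains all the minimizers: a rectangle B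
    in a (possibly degenerate) notch of an L-shaped hexagon A ([notched], [box]).
    Both sets are star-shaped, hence simply connected
    ([star_shaped_simply_connected]), and their boundaries are parametrized by
    arc length. *)

(** * The scalar optimization *)

Definition corner_perim {R : realType} (al : R) : R :=
  4 * Num.sqrt (1 + al) + 2 * Num.sqrt al.
Definition side_perim {R : realType} (al : R) : R :=
  4 + 2 * Num.sqrt (2 * al).
Definition stack_perim {R : realType} (al : R) : R :=
  2 * Num.sqrt (6 * (1 + al)).
Definition min_perim {R : realType} (al : R) : R :=
  if al <= 1 / 2 then Num.min (corner_perim al) (side_perim al)
  else stack_perim al.

Section Numeric.
Context {R : realType}.
Implicit Types (a b c d e f p q al : R).

Lemma two_sqrt_le_add (a b p : R) : 0 <= a -> 0 <= b -> p <= a * b ->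
  2 * Num.sqrt p <= a + b.
Proof.
move=> a0 b0 pab.
have [p0|p0] := leP p 0.
  by rewrite (ler0_sqrtr p0); lra.
have s0 := sqrtr_ge0 p; have := sqr_sqrtr (ltW p0).
move: (Num.sqrt p) s0 => s s0 sE.
rewrite -(@ler_pXn2r _ 2) ?nnegrE; [|by []|lra|lra].
have := sqr_ge0 (a - b); rewrite !expr2 in sE *; nra.
Qed.

Lemma eqW (x y : R) : x = y -> x <= y. Proof. by move->. Qed.

(** The convex function x |-> p / x lies above its tangent at w. *)
Lemma tangent_inv (p x w : R) : 0 <= p -> 0 < x -> 0 < w ->
  2 * (p / w) - p * x / w ^+ 2 <= p / x.
Proof.
move=> p0 x0 w0.
rewrite -subr_ge0.
have -> : p / x - (2 * (p / w) - p * x / w ^+ 2) = p * (w - x) ^+ 2 / (x * w ^+ 2).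
  by field; rewrite ?gt_eqF.
by apply: divr_ge0; apply: mulr_ge0; rewrite ?sqr_ge0 ?(ltW x0).
Qed.

(** On the half plane d <= b the convex right-hand side is least on the
    diagonal b = d = w, so the sum of the tangent bounds at w suffices: their
    linear parts cancel on the diagonal and are nonnegative below it. *)
Lemma stack_bound (p q b d w : R) : 0 < p -> 0 < q -> 0 < w ->
  3 * w ^+ 2 = 2 * (p + q) -> p <= w ^+ 2 -> 0 < d -> d <= b ->
  6 * w <= 2 * b + 2 * (p / b) + d + 2 * (q / d).
Proof.
move=> p0 q0 w0 wE pw d0 db.
have b0 : 0 < b by lra.
have h1 := tangent_inv (ltW p0) b0 w0.
have h2 := tangent_inv (ltW q0) d0 w0.
have w2 : 0 < w ^+ 2 by rewrite exprn_gt0.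
have k : 4 * (p / w) + 4 * (q / w) = 6 * w.
  have -> : 4 * (p / w) + 4 * (q / w) = 2 * (2 * (p + q)) / w.
    by field; rewrite gt_eqF.
  by rewrite -wE; field; rewrite gt_eqF.
set x := p / w ^+ 2 in h1 *; set y := q / w ^+ 2 in h2 *.
have h1' : p * b / w ^+ 2 = b * x by rewrite /x; field; rewrite gt_eqF.
have h2' : q * d / w ^+ 2 = d * y by rewrite /y; field; rewrite gt_eqF.
rewrite h1' in h1; rewrite h2' in h2.
have e1 : 0 <= 1 - x by rewrite subr_ge0 ler_pdivrMr // mul1r.
have e2 : 1 - 2 * y = - 2 * (1 - x).
  have : 2 * (x + y) = 3.
    rewrite -[RHS](@mulfK _ (w ^+ 2)) ?gt_eqF // wE /x /y.
    by field; rewrite gt_eqF.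
  lra.
have : 0 <= 2 * b * (1 - x) + d * (1 - 2 * y) by rewrite e2; nra.
lra.
Qed.

(** The right-hand side is 2 (a + b) + d + c + (c - e), where c - e is the part
    of B outside the strip over A. Writing a b = p + t q, the area of the union
    forces (c - e) d >= (1 - t) q, and the resulting bound is affine in t. At
    t = 0 the two boxes are adjacent (the second hypothesis on L); at t = 1 the
    box B lies in the strip and the bounding box carries the whole area p + q
    (the first one). *)
Lemma overlap_bound (p q L a b c d e : R) : 0 < p -> 0 < q ->
  L <= 4 * Num.sqrt (p + q) + 2 * Num.sqrt q ->
  (forall b d, 0 < d -> d <= b -> L <= 2 * b + 2 * (p / b) + d + 2 * (q / d)) ->
  0 < d -> d <= b -> p <= a * b -> q <= c * d -> 0 <= e -> 0 <= a -> 0 <= c ->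
  p + q <= a * b + (c - e) * d -> e <= c ->
  L <= 2 * (a + b) + d + 2 * c - e.
Proof.
move=> p0 q0 L2 L1 d0 db ab cd e0 a0 c0 un ec.
have b0 : 0 < b by lra.
have [T|T] := leP (p + q) (a * b).
  have h1 := two_sqrt_le_add a0 (ltW b0) T.
  have h2 := two_sqrt_le_add c0 (ltW d0) cd.
  lra.
set t := (a * b - p) / q.
have tE : a * b = p + t * q by rewrite /t; field; rewrite gt_eqF.
have t0 : 0 <= t by rewrite divr_ge0 ?(ltW q0) // subr_ge0.
have t1 : t <= 1 by rewrite ler_pdivrMr //; lra.
have aE : a = p / b + t * (q / b).
  by rewrite -[LHS](mulfK (lt0r_neq0 b0)) tE; field; rewrite gt_eqF.
have cE : 2 * (q / d) - t * (q / d) <= 2 * c - e.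
  have -> : 2 * (q / d) - t * (q / d) = (2 * q - t * q) / d.
    by field; rewrite gt_eqF.
  by rewrite ler_pdivrMr //; nra.
have h1 := L1 _ _ d0 db.
have h2 : L <= 2 * b + 2 * (p / b + q / b) + d + q / d.
  have pq : p + q <= b * (p / b + q / b).
    by apply/eqW; field; rewrite gt_eqF.
  have qq : q <= d * (q / d) by apply/eqW; field; rewrite gt_eqF.
  have := two_sqrt_le_add (ltW b0) _ pq.
  have := two_sqrt_le_add (ltW d0) _ qq.
  move=> /(_ _)-/(_ (divr_ge0 (ltW q0) (ltW d0))).
  move=> g1 /(_ (addr_ge0 (divr_ge0 (ltW p0) (ltW b0)) (divr_ge0 (ltW q0) (ltW b0)))).
  lra.
have : 0 <= (1 - t) * (2 * b + 2 * (p / b) + d + 2 * (q / d) - L)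
  + t * (2 * b + 2 * (p / b + q / b) + d + q / d - L).
  by rewrite addr_ge0 // mulr_ge0 //; lra.
rewrite aE; lra.
Qed.

Section TwoBoxes.
Variables (al L : R).
Hypotheses (al0 : 0 < al) (al1 : al <= 1).
Hypothesis Lcorner : L <= corner_perim al.
Hypothesis LB : forall b d, 0 < d -> d <= b ->
  L <= 2 * b + 2 * (1 / b) + d + 2 * (al / d).
Hypothesis LA : forall b d, 0 < d -> d <= b ->
  L <= 2 * b + 2 * (al / b) + d + 2 * (1 / d).

(** Nested vertical shadows: the smaller height decides which of the two boxes
    plays the role of the container. *)
Lemma two_boxes_nested (a b c d e : R) : 0 <= a -> 0 <= b -> 0 <= c -> 0 <= d ->
  0 <= e -> e <= a -> e <= c -> 1 <= a * b -> al <= c * d ->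
  1 + al <= a * b + c * d - e * Num.min b d ->
  L <= 2 * (a + b + c + d) - e - Num.min b d.
Proof.
move=> a0 b0 c0 d0 e0 ea ec ab cd.
have b1 : 0 < b by rewrite lt_neqAle b0 andbT; apply: contraTN ab => /eqP<-; rewrite mulr0 ler10.
have d1 : 0 < d by rewrite lt_neqAle d0 andbT; apply: contraTN cd => /eqP<-; rewrite mulr0 -ltNge.
have [bd|db] := ltP b d => un.
- have h2 : L <= 4 * Num.sqrt (al + 1) + 2 * Num.sqrt 1.
    rewrite (addrC al) (le_trans Lcorner) // /corner_perim.
    have := ler_wsqrtr al1; lra.
  have := @overlap_bound al 1 L c d a b e al0 ltr01 h2 LA b1 (ltW bd) cd ab e0 c0 a0.
  move=> /(_ _ ea); lra.
- have := @overlap_bound 1 al L a b c d e ltr01 al0 Lcorner LB d1 db ab cd e0 a0 c0.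
  move=> /(_ _ ec); lra.
Qed.

(** Replacing (e, f) by (e - x, f + x) with e <= f keeps the perimeter and lowers
    the overlap area e f, so f may be pushed up to the smaller height, or e
    down to 0. *)
Lemma two_boxes_aux (a b c d e f : R) : 0 <= a -> 0 <= b -> 0 <= c -> 0 <= d ->
  0 <= e -> e <= a -> e <= c -> 0 <= f -> f <= b -> f <= d -> e <= f ->
  1 <= a * b -> al <= c * d -> 1 + al <= a * b + c * d - e * f ->
  L <= 2 * (a + b + c + d) - e - f.
Proof.
move=> a0 b0 c0 d0 e0 ea ec f0 fb fd ef ab cd un.
set m := Num.min b d.
have fm : f <= m by rewrite le_min fb fd.
have [em|em] := leP e (m - f).
  have := @two_boxes_nested a b c d 0 a0 b0 c0 d0 (lexx _) a0 c0 ab cd.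
  rewrite -/m mul0r; lra.
have := @two_boxes_nested a b c d (e - (m - f)) a0 b0 c0 d0.
rewrite -/m; nra.
Qed.

Lemma two_boxes (a b c d e f : R) : 0 <= a -> 0 <= b -> 0 <= c -> 0 <= d ->
  0 <= e -> e <= a -> e <= c -> 0 <= f -> f <= b -> f <= d ->
  1 <= a * b -> al <= c * d -> 1 + al <= a * b + c * d - e * f ->
  L <= 2 * (a + b + c + d) - e - f.
Proof.
move=> a0 b0 c0 d0 e0 ea ec f0 fb fd ab cd un.
have [ef|fe] := leP e f; first exact: two_boxes_aux.
have := @two_boxes_aux b a d c f e b0 a0 d0 c0 f0 fb fd e0 ea ec (ltW fe).
rewrite (mulrC b) (mulrC d) (mulrC f); lra.
Qed.

End TwoBoxes.

(** w is the common width of the two optimal stacked rectangles. *)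
Lemma stack_perimE (al : R) : 0 < al ->
  exists w : R, [/\ 0 < w, 3 * w ^+ 2 = 2 * (1 + al) & stack_perim al = 6 * w].
Proof.
move=> al0; have h : 0 <= 2 / 3 * (1 + al) by lra.
have h' : 0 < 2 / 3 * (1 + al) by lra.
exists (Num.sqrt (2 / 3 * (1 + al))); split.
- by rewrite sqrtr_gt0.
- by rewrite sqr_sqrtr //; lra.
- have -> : (6 : R) * Num.sqrt (2 / 3 * (1 + al))
      = 2 * Num.sqrt (3 ^+ 2 * (2 / 3 * (1 + al))).
    by rewrite [in RHS]sqrtrM ?sqr_ge0 // sqrtr_sqr ger0_norm //; lra.
  by rewrite /stack_perim; congr (2 * Num.sqrt _); field.
Qed.

Lemma stack_le_corner (al : R) : 1 / 2 <= al ->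
  stack_perim al <= corner_perim al.
Proof.
move=> al2; have al0 : 0 < al by lra.
have [w [w0 wE ->]] := stack_perimE al0.
rewrite /corner_perim.
have e1 := sqr_sqrtr (ltW al0); have e2 : Num.sqrt (1 + al) ^+ 2 = 1 + al.
  by rewrite sqr_sqrtr //; lra.
have := sqrtr_ge0 al; have := sqrtr_ge0 (1 + al).
move: (Num.sqrt al) (Num.sqrt (1 + al)) e1 e2 => s t e1 e2 t0 s0.
rewrite !expr2 in e1 e2 wE.
(* al >= 1 / 2 gives 2 s >= t, while w / t = sqrt (2 / 3) < 5 / 6 *)
have w1 : w <= 5 / 6 * t by nra.
have s1 : t <= 2 * s by nra.
lra.
Qed.

Lemma side_le_stack (al : R) : 0 < al -> side_perim al <= stack_perim al.
Proof.
move=> al0.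
have [w [w0 wE ->]] := stack_perimE al0.
rewrite /side_perim.
have e1 : Num.sqrt (2 * al) ^+ 2 = 2 * al by rewrite sqr_sqrtr //; lra.
have := sqrtr_ge0 (2 * al).
move: (Num.sqrt _) e1 => s e1 s0.
rewrite !expr2 in e1 wE.
have : (2 + s) * (2 + s) <= (3 * w) * (3 * w) by have := sqr_ge0 (1 - s); rewrite expr2; lra.
rewrite -!expr2 ler_pXn2r // ?nnegrE; lra.
Qed.

(** The isoperimetric problem for two overlapping boxes: a, b and c, d are the
    sides of the boxes and e, f those of their intersection. *)
Lemma two_boxes_min_perim (al a b c d e f : R) : 0 < al -> al <= 1 ->
  0 <= a -> 0 <= b -> 0 <= c -> 0 <= d ->
  0 <= e -> e <= a -> e <= c -> 0 <= f -> f <= b -> f <= d ->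
  1 <= a * b -> al <= c * d -> 1 + al <= a * b + c * d - e * f ->
  min_perim al <= 2 * (a + b + c + d) - e - f.
Proof.
move=> al0 al1.
have [w [w0 wE swE]] := stack_perimE al0.
have HA b' d' : 0 < d' -> d' <= b' ->
    stack_perim al <= 2 * b' + 2 * (al / b') + d' + 2 * (1 / d').
  move=> d0 db; rewrite swE; apply: stack_bound => //; lra.
rewrite /min_perim => a0 b0 c0 d0 e0 ea ec f0 fb fd ab cd un; case: (leP al (1 / 2)) => al2.
- apply: (two_boxes (al := al)) => //.
  + by rewrite ge_min lexx.
  + move=> b' d' d1 db; rewrite ge_min; apply/orP; right.
    have b1 : 0 < b' by lra.
    have := @two_sqrt_le_add b' (1 / b') 1 (ltW b1).
    have := @two_sqrt_le_add d' (2 * al / d') (2 * al) (ltW d1).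
    have -> : 1 <= b' * (1 / b') by apply/eqW; field; rewrite gt_eqF.
    have -> : 2 * al <= d' * (2 * al / d') by apply/eqW; field; rewrite gt_eqF.
    have i1 : 0 <= 1 / b' by rewrite divr_ge0 // ltW.
    have i2 : 0 <= 2 * al / d' by rewrite divr_ge0 //; lra.
    move=> /(_ i2 isT) h2 /(_ i1 isT); rewrite sqrtr1 /side_perim; lra.
  + move=> b' d' d1 db; apply: le_trans (HA _ _ d1 db).
    by rewrite ge_min side_le_stack // orbT.
- apply: (two_boxes (al := al)) => //; first by apply: stack_le_corner; lra.
  move=> b' d' d1 db; rewrite swE; apply: stack_bound => //; lra.
Qed.

End Numeric.

(** * Length of curves *)

Section Rho.
Context {R : realType}.
Implicit Types (l : R -> R * R) (a b c s t : R).

Lemma l1dist_ge0 (p q : R * R) : 0 <= l1dist p q.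
Proof. by rewrite addr_ge0. Qed.

Lemma l1distC (p q : R * R) : l1dist p q = l1dist q p.
Proof. by rewrite /l1dist distrC (distrC q.2). Qed.

Lemma sum_le_rho a b l (N : nat) (t : nat -> R) :
  (forall i, (i <= N)%N -> a <= t i <= b) ->
  (forall i, (i < N)%N -> t i <= t i.+1) ->
  ((\sum_(0 <= i < N) l1dist (l (t i)) (l (t i.+1)))%:E <= rho a b l)%E.
Proof.
move=> tab tle; apply: ereal_sup_ubound.
by exists N.+1, t; split.
Qed.

Lemma rho_leP a b l (x : \bar R) :
  (forall (N : nat) (t : nat -> R),
    (forall i, (i <= N)%N -> a <= t i <= b) ->
    (forall i, (i < N)%N -> t i <= t i.+1) ->
    ((\sum_(0 <= i < N) l1dist (l (t i)) (l (t i.+1)))%:E <= x)%E) ->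
  (rho a b l <= x)%E.
Proof.
move=> h; apply: ge_ereal_sup => _ [[|N] [t [// _ tab tle ->]]].
by apply: h => i iN; [apply: tab|apply: tle].
Qed.

Lemma rho_ge0 a b l : a <= b -> (0 <= rho a b l)%E.
Proof.
move=> ab; have := @sum_le_rho a b l 0 (fun=> a).
by rewrite big_geq //; apply => // i _; rewrite lexx ab.
Qed.

Lemma le_rho a b a' b' l : a' <= a -> b <= b' -> (rho a b l <= rho a' b' l)%E.
Proof.
move=> aa bb; apply: rho_leP => N t tab tle; apply: sum_le_rho => // i /tab.
by move=> /andP[h1 h2]; rewrite (le_trans aa) //= (le_trans h2).
Qed.

Lemma four_points_rho a b l t0 t1 t2 t3 :
  a <= t0 -> t0 <= t1 -> t1 <= t2 -> t2 <= t3 -> t3 <= b ->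
  ((l1dist (l t0) (l t1) + l1dist (l t1) (l t2) + l1dist (l t2) (l t3))%:E
    <= rho a b l)%E.
Proof.
move=> h0 h1 h2 h3 h4.
have := @sum_le_rho a b l 3 (nth t3 [:: t0; t1; t2; t3]).
rewrite !big_nat_recr //= big_geq //= add0r; apply.
- by case=> [|[|[|[|]]]] //= _; lra.
- by case=> [|[|[|]]] //= _; lra.
Qed.

Lemma l1dist_le_rho a b l s t : a <= s <= b -> a <= t <= b ->
  ((l1dist (l s) (l t))%:E <= rho a b l)%E.
Proof.
wlog st : s t / s <= t.
  move=> h sab tab; have [st|ts] := leP s t; first exact: h.
  by rewrite l1distC; apply: h => //; exact: ltW.
move=> /andP[as_ sb] /andP[at_ tb].
apply: le_trans (@four_points_rho a b l s t t t _ _ _ _ _) => //.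
rewrite lee_fin; have := l1dist_ge0 (l t) (l t); lra.
Qed.

(** Sorting the four parameters gives a subdivision; each of the two
    oscillations is then bounded by the triangle inequality. *)
Lemma osc_le_rho a b l s t p q : a <= s <= b -> a <= t <= b ->
  a <= p <= b -> a <= q <= b ->
  ((`|(l t).1 - (l s).1| + `|(l q).2 - (l p).2|)%:E <= rho a b l)%E.
Proof.
wlog st : s t / s <= t.
  move=> h; have [st|/ltW ts] := leP s t; first exact: h.
  by move=> *; rewrite distrC; apply: h.
wlog pq : p q / p <= q.
  move=> h; have [pq|/ltW qp] := leP p q; first exact: h.
  by move=> *; rewrite (distrC (l q).2); apply: h.
move=> /andP[as_ sb] /andP[at_ tb] /andP[ap pb] /andP[aq qb].
have bnd t0 t1 t2 t3 (x : R) :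
    x <= l1dist (l t0) (l t1) + l1dist (l t1) (l t2) + l1dist (l t2) (l t3) ->
    a <= t0 -> t0 <= t1 -> t1 <= t2 -> t2 <= t3 -> t3 <= b -> (x%:E <= rho a b l)%E.
  move=> xle *; apply: le_trans (@four_points_rho a b l t0 t1 t2 t3 _ _ _ _ _) => //.
rewrite /l1dist in bnd.
have tri (x y z : R) : `|z - x| <= `|y - x| + `|z - y|.
  by have := ler_normD (y - x) (z - y); rewrite addrC subrKA.
have nn (x : R) : 0 <= `|x| by [].
have [sp|ps] := leP s p; last have {}ps := ltW ps.
- have [tp|pt] := leP t p; last have {}pt := ltW pt.
  + by apply: (bnd s t p q) => //; rewrite -!addrA; have := nn ((l t).2 - (l s).2);
    have := nn ((l p).2 - (l t).2); have := nn ((l p).1 - (l t).1); have := nn ((l q).1 - (l p).1); lra.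
  + have [qt|tq] := leP q t; last have {}tq := ltW tq.
    * apply: (bnd s p q t) => //.
      have := tri (l s).1 (l p).1 (l t).1; have := tri (l p).1 (l q).1 (l t).1.
      have := nn ((l p).2 - (l s).2); have := nn ((l t).2 - (l q).2); lra.
    * apply: (bnd s p t q) => //.
      have := tri (l s).1 (l p).1 (l t).1; have := tri (l p).2 (l t).2 (l q).2.
      have := nn ((l p).2 - (l s).2); have := nn ((l q).1 - (l t).1); lra.
- have [qs|sq] := leP q s; last have {}sq := ltW sq.
  + by apply: (bnd p q s t) => //; have := nn ((l q).1 - (l p).1);
    have := nn ((l s).2 - (l q).2); have := nn ((l s).1 - (l q).1); have := nn ((l t).2 - (l s).2); lra.
  + have [tq|qt] := leP t q; last have {}qt := ltW qt.
    * apply: (bnd p s t q) => //.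
      have := tri (l p).2 (l s).2 (l q).2; have := tri (l s).2 (l t).2 (l q).2.
      have := nn ((l s).1 - (l p).1); have := nn ((l q).1 - (l t).1); lra.
    * apply: (bnd p s q t) => //.
      have := tri (l p).2 (l s).2 (l q).2; have := tri (l s).1 (l q).1 (l t).1.
      have := nn ((l s).1 - (l p).1); have := nn ((l t).2 - (l q).2); lra.
Qed.

Lemma rho_superadditive a b c l : a <= b -> b <= c ->
  (rho a b l + rho b c l <= rho a c l)%E.
Proof.
move=> ab bc.
have b0 := rho_ge0 l bc.
have bX : (rho b c l <= rho a c l)%E by apply: le_rho.
case E : (rho b c l) => [r| |]; last 2 first.
- by move: bX; rewrite E leye_eq => /eqP ->; rewrite leey.
- by move: b0; rewrite E.
rewrite -leeBrDr //; apply: rho_leP => N t tab tle.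
rewrite leeBrDr // addeC -leeBrDr // -E; apply: rho_leP => N' t' tab' tle'.
rewrite leeBrDr // -EFinD addrC.
pose u i := if (i <= N)%N then t i else t' (i - N.+1)%N.
apply: (@le_trans _ _
   (\sum_(0 <= i < N.+1 + N') l1dist (l (u i)) (l (u i.+1)))%:E).
  have h1 : \sum_(0 <= i < N) l1dist (l (t i)) (l (t i.+1)) =
      \sum_(0 <= i < N) l1dist (l (u i)) (l (u i.+1)).
    by apply: eq_big_nat => i /andP[_ iN]; rewrite /u iN (ltnW iN).
  have h2 : \sum_(0 <= i < N') l1dist (l (t' i)) (l (t' i.+1)) =
      \sum_(N.+1 <= i < N.+1 + N') l1dist (l (u i)) (l (u i.+1)).
    rewrite -{1}[N.+1]add0n big_addn addKn.
    apply: eq_big_nat => i _; rewrite /u !ifF; [|lia|lia].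
    by rewrite -addSn !addnK.
  rewrite lee_fin h1 h2 (@big_cat_nat _ _ _ N 0%N (N.+1 + N')) /=; [|lia|lia].
  rewrite lerD2l (@big_ltn _ _ _ N); last by lia.
  by rewrite lerDr l1dist_ge0.
apply: sum_le_rho => i iN.
- rewrite /u; case: leqP => iN'.
    by have /andP[-> h] := tab _ iN'; rewrite (le_trans h).
  have := tab' (i - N.+1)%N; have -> : (i - N.+1 <= N')%N by lia.
  by move=> /(_ isT)/andP[h ->]; rewrite (le_trans ab).
- rewrite /u; case: (ltnP i N) => iN'.
    by rewrite (ltnW iN') tle.
  have [->|iNn] := eqVneq i N.
    rewrite leqnn subnn.
    have /andP[_ h] := tab _ (leqnn N); have /andP[h' _] := tab' 0%N isT.
    exact: le_trans h'.
  rewrite ifF; last by lia.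
  have -> : (i.+1 - N.+1 = (i - N.+1).+1)%N by lia.
  by apply: tle'; lia.
Qed.

Lemma rho_le_lipschitz a b l (K : R) : a <= b -> 0 <= K ->
  (forall s t, a <= s -> s <= t -> t <= b -> l1dist (l s) (l t) <= K * (t - s)) ->
  (rho a b l <= (K * (b - a))%:E)%E.
Proof.
move=> ab K0 h; apply: rho_leP => N t tab tle; rewrite lee_fin.
apply: (@le_trans _ _ (K * (t N - t 0%N))).
  elim: N tab tle => [|N IH] tab tle; first by rewrite big_geq // subrr mulr0.
  rewrite big_nat_recr //=.
  have {}IH := IH (fun i iN => tab i (leqW iN)) (fun i iN => tle i (ltnW iN)).
  have := h (t N) (t N.+1).
  have /andP[-> _] := tab N (leqnSn N).
  have /andP[_ ->] := tab N.+1 (leqnn _).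
  rewrite tle // => /(_ isT isT isT); rewrite !mulrBr in IH *; lra.
have /andP[? ?] := tab N (leqnn _); have /andP[? ?] := tab 0%N isT.
by rewrite ler_wpM2l // lerB.
Qed.

End Rho.

(** * Counting the points of a curve on lines *)

Section LiminfBounds.
Context {R : realType}.
Local Open Scope ereal_scope.

Lemma limn_einf_ge (u : (\bar R)^nat) (x : \bar R) n0 :
  (forall n, (n0 <= n)%N -> x <= u n) -> x <= limn_einf u.
Proof.
move=> h; rewrite limn_einf_lim (cvg_lim _ (@cvg_einfs_sup _ u)) //.
apply: (@le_trans _ _ (einfs u n0)); last first.
  by apply: ereal_sup_ubound; exists n0.
by apply: le_ereal_inf_tmp => _ [m /= nm <-]; exact: h.
Qed.

Lemma limn_einf_le (u : (\bar R)^nat) (x : \bar R) :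
  (forall n, u n <= x) -> limn_einf u <= x.
Proof.
move=> h; rewrite limn_einf_lim (cvg_lim _ (@cvg_einfs_sup _ u)) //.
apply: ge_ereal_sup => _ [n _ <-]; apply: le_trans (h n).
by apply: ereal_inf_lbound; exists n => /=.
Qed.

Lemma measurable_limn_einf (f : (R -> \bar R)^nat) :
  (forall n, measurable_fun setT (f n)) ->
  measurable_fun setT (fun x => limn_einf (f ^~ x)).
Proof.
move=> mf; rewrite /limn_einf; apply: measurableT_comp => //.
apply: (@measurable_fun_limn_esup _ _ _ _ (fun n x => - f n x)) => n.
exact: measurableT_comp.
Qed.

End LiminfBounds.

Section Banach.
Context {R : realType}.
Implicit Types (l : R -> R * R) (a b c s t : R).

Lemma lebesgue_measure_segment a b : a <= b ->
  lebesgue_measure (`[a, b]%classic : set R) = (b - a)%:E.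
Proof.
move=> ab; rewrite lebesgue_measure_itv /= lte_fin lt_neqAle ab andbT.
by have [->|] := eqVneq a b; rewrite ?subrr.
Qed.

Lemma rho_sum l (p : nat -> R) N : (forall i, (i < N)%N -> p i <= p i.+1) ->
  (\sum_(0 <= i < N) rho (p i) (p i.+1) l <= rho (p 0%N) (p N) l)%E.
Proof.
elim: N => [|N IH] h; first by rewrite big_geq // rho_ge0.
rewrite big_nat_recr //=.
have p0N : p 0%N <= p N.
  have {}h : forall i, (i < N)%N -> p i <= p i.+1 by move=> i iN; apply: h; lia.
  elim: N h {IH} => // N IH h; apply: le_trans (h N (leqnn _)).
  by apply: IH => i iN; apply: h; lia.
apply: le_trans (rho_superadditive l p0N (h N (leqnn _))).
by rewrite leeD2r // IH // => i iN; apply: h; lia.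
Qed.

Lemma continuous_fst_subspace l (A : set R) : {within A, continuous l} ->
  {within A, continuous (fun t => (l t).1)}.
Proof. by move=> cl x; apply: cvg_comp (cl x) _; exact: cvg_fst. Qed.

Lemma continuous_snd_subspace l (A : set R) : {within A, continuous l} ->
  {within A, continuous (fun t => (l t).2)}.
Proof. by move=> cl x; apply: cvg_comp (cl x) _; exact: cvg_snd. Qed.

(** Bounding boxes of short arcs are the tiles used to count the points of the
    curve on lines: the half perimeter of the box is at most the length. *)
Lemma box_le_rho l a b : a <= b -> {within `[a, b], continuous l} ->
  exists x : R * R * (R * R), [/\ x.1.1 <= x.1.2, x.2.1 <= x.2.2,
    (((x.1.2 - x.1.1) + (x.2.2 - x.2.1))%:E <= rho a b l)%E &
    forall t, a <= t <= b ->
      x.1.1 <= (l t).1 <= x.1.2 /\ x.2.1 <= (l t).2 <= x.2.2].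
Proof.
move=> ab cl.
have [s sab sh] := EVT_min ab (continuous_fst_subspace cl).
have [t tab th] := EVT_max ab (continuous_fst_subspace cl).
have [p pab ph] := EVT_min ab (continuous_snd_subspace cl).
have [q qab qh] := EVT_max ab (continuous_snd_subspace cl).
exists (((l s).1, (l t).1), ((l p).2, (l q).2)) => /=.
have h1 := sh t tab; have h2 := ph q qab; split => //.
- apply: le_trans (osc_le_rho l sab tab pab qab).
  by rewrite lee_fin lerD // ler_norm.
- by move=> u uab; rewrite sh // th // ph // qh.
Qed.

Lemma piece_of_point (p : nat -> R) N t : p 0%N <= t -> t <= p N.+1 ->
  exists2 i, (i <= N)%N & p i <= t <= p i.+1.
Proof.
elim: N => [|N IH] pt tp; first by exists 0%N => //; rewrite pt tp.
have [h|h] := leP t (p N.+1).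
  by have [i iN it] := IH pt h; exists i => //; exact: leqW.
by exists N.+1 => //; rewrite (ltW h) tp.
Qed.

Lemma pos_lower_bound (xs : seq R) : (forall x, x \in xs -> 0 < x) ->
  exists2 d : R, 0 < d & forall x, x \in xs -> d <= x.
Proof.
elim: xs => [|x xs IH] h; first by exists 1.
have [|d d0 dx] := IH; first by move=> y ys; apply: h; rewrite inE ys orbT.
exists (Num.min x d); first by rewrite lt_min d0 h // inE eqxx.
move=> y; rewrite inE ge_min => /orP[/eqP->|/dx ->]; rewrite ?lexx //.
by rewrite orbT.
Qed.

Lemma separation (ts : seq R) : exists2 d : R, 0 < d &
  forall s t, s \in ts -> t \in ts -> s != t -> d <= `|s - t|.
Proof.
have [|d d0 dx] := @pos_lower_bound
    [seq x <- [seq `|s - t| | s <- ts, t <- ts] | x > 0].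
  by move=> x; rewrite mem_filter => /andP[].
exists d => // s t sts tts st; apply: dx; rewrite mem_filter normr_gt0 subr_eq0 st.
by apply/allpairsP; exists (s, t).
Qed.

Lemma count_le_sum (N : nat) (I : nat -> set R) (u : R) (js : seq nat) :
  uniq js -> (forall j, j \in js -> (j < N)%N /\ I j u) ->
  (size js)%:R <= \sum_(0 <= i < N) (\1_(I i) u : R).
Proof.
move=> ujs h; rewrite big_mkord.
under eq_bigr do rewrite indicE.
rewrite -natr_sum ler_nat -(big_mkord xpredT (fun i => nat_of_bool (u \in I i))).
rewrite (eq_bigr (fun i => if u \in I i then 1 else 0)%N); last first.
  by move=> i _; case: (_ \in _).
rewrite -big_mkcond sum1_count -size_filter; apply: uniq_leq_size => // j jj.
have [jN Ij] := h j jj; rewrite mem_filter mem_index_iota jN andbT.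
by rewrite leq0n andbT mem_set.
Qed.

(** Once the mesh is below the least distance between the given parameters, they
    lie in distinct pieces. *)
Lemma distinct_pieces a b (ts : seq R) : a <= b -> uniq ts ->
  (forall t, t \in ts -> a <= t <= b) ->
  exists n0, forall n, (n0 <= n)%N -> forall I : nat -> set R, forall u : R,
    (forall i t, (i < n.+1)%N -> t \in ts ->
      a + i%:R * ((b - a) / n.+1%:R) <= t <= a + i.+1%:R * ((b - a) / n.+1%:R) ->
      I i u) ->
    (size ts)%:R <= \sum_(0 <= i < n.+1) (\1_(I i) u : R).
Proof.
move=> ab uts tsab; have [d d0 dts] := separation ts.
exists (Num.trunc ((b - a) / d)) => n nN I u Iu.
set m := (b - a) / n.+1%:R in Iu *.
pose p i := a + i%:R * m.
have n0 : 0 < n.+1%:R :> R by rewrite ltr0n.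
have md : m < d.
  rewrite /m ltr_pdivrMr // mulrC -ltr_pdivrMr //.
  by apply: lt_le_trans (truncnS_gt _) _; rewrite ler_nat ltnS.
have /choice[g gP] : forall t, exists i, t \in ts ->
    (i < n.+1)%N /\ p i <= t <= p i.+1.
  move=> t; have [tts|] := boolP (t \in ts); last by exists 0%N.
  have /andP[at_ tb] := tsab _ tts.
  have [||i iN it] := @piece_of_point p n t.
  - by rewrite /p mul0r addr0.
  - by rewrite /p /m mulrC divfK ?gt_eqF // addrC subrK.
  by exists i.
rewrite -(size_map g); apply: count_le_sum.
  rewrite map_inj_in_uniq // => s t sts tts gst.
  apply/eqP; apply: contraTT isT => st; exfalso.
  have [_ /andP[h1 h2]] := gP _ sts; have [_ /andP[h3 h4]] := gP _ tts.
  have := dts _ _ sts tts st; rewrite leNgt => /negP; apply.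
  apply: le_lt_trans md; rewrite ler_norml.
  rewrite gst /p -natr1 in h1 h2; rewrite /p -natr1 in h3 h4; lra.
move=> _ /mapP[t tts ->]; have [iN it] := gP _ tts; split=> //.
exact: Iu it.
Qed.

(** M u is the lower limit, along finer and finer regular subdivisions, of the
    number of pieces whose bounding box meets the vertical or the horizontal
    line at u. Each count integrates to a sum of half perimeters of boxes, hence
    to at most the length, and the bound passes to the limit by Fatou's lemma.
    Fibres may be infinite, which is why only finite subsets are counted. *)
Theorem banach_indicatrix l a b : a <= b -> {within `[a, b], continuous l} ->
  exists M : R -> \bar R, [/\ measurable_fun setT M, (forall u, 0 <= M u)%E,
    (\int[lebesgue_measure]_u M u <= rho a b l)%E &
    forall u (ts ts' : seq R), uniq ts -> uniq ts' ->
      (forall t, t \in ts -> a <= t <= b /\ (l t).1 = u) ->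
      (forall t, t \in ts' -> a <= t <= b /\ (l t).2 = u) ->
      ((size ts + size ts')%:R%:E <= M u)%E].
Proof.
move=> ab cl.
pose p n i := a + i%:R * ((b - a) / n.+1%:R).
have ple n i : p n i <= p n i.+1.
  by rewrite /p lerD2l ler_wpM2r ?ler_nat // divr_ge0 // subr_ge0.
have pa n i : a <= p n i.
  by rewrite /p lerDl mulr_ge0 // divr_ge0 // subr_ge0.
have p0 n : p n 0%N = a by rewrite /p mul0r addr0.
have pn n : p n n.+1 = b.
  by rewrite /p mulrC divfK ?gt_eqF ?ltr0n // addrC subrK.
have pb n i : (i <= n.+1)%N -> p n i <= b.
  move=> iN; rewrite -(pn n) /p lerD2l ler_wpM2r ?ler_nat //.
  by rewrite divr_ge0 // subr_ge0.
have /choice[x xP] : forall ni : nat * nat, exists x : R * R * (R * R),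
    (ni.2 < ni.1.+1)%N ->
    [/\ x.1.1 <= x.1.2, x.2.1 <= x.2.2,
    (((x.1.2 - x.1.1) + (x.2.2 - x.2.1))%:E <= rho (p ni.1 ni.2) (p ni.1 ni.2.+1) l)%E &
    forall t, p ni.1 ni.2 <= t <= p ni.1 ni.2.+1 ->
      x.1.1 <= (l t).1 <= x.1.2 /\ x.2.1 <= (l t).2 <= x.2.2].
  move=> [n i] /=; have [iN|] := ltnP i n.+1; last by exists ((0, 0), (0, 0)).
  have cl' : {within `[p n i, p n i.+1], continuous l}.
    apply: continuous_subspaceW cl; apply: subset_itv; rewrite bnd_simp ?pa //.
    exact: pb.
  by have [y yP] := box_le_rho (ple n i) cl'; exists y.
pose I1 n i : set R := (`[(x (n, i)).1.1, (x (n, i)).1.2])%classic.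
pose I2 n i : set R := (`[(x (n, i)).2.1, (x (n, i)).2.2])%classic.
pose g n i u : \bar R := ((\1_(I1 n i) u)%:E + (\1_(I2 n i) u)%:E)%E.
pose f n u := (\sum_(0 <= i < n.+1) g n i u)%E.
have mg n i : measurable_fun setT (g n i).
  by apply: emeasurable_funD; apply/measurable_EFinP; apply: measurable_indic;
    exact: measurable_itv.
have g0 n i u : (0 <= g n i u)%E by rewrite adde_ge0 // lee_fin.
have mf n : measurable_fun setT (f n).
  by rewrite /f; apply: emeasurable_sum => i; exact: mg.
have f0 n u : (0 <= f n u)%E by rewrite /f sume_ge0.
exists (fun u => limn_einf (f ^~ u)); split.
- exact: measurable_limn_einf.
- by move=> u; apply: (@limn_einf_ge _ _ _ 0%N) => n _.
- have := @fatou _ _ R lebesgue_measure setT measurableT f mf (fun n u _ => f0 n u).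
  move=> /le_trans; apply.
  apply: limn_einf_le => n.
  rewrite /f ge0_integral_sum //; last by move=> i; exact: mg.
  rewrite -(p0 n) -(pn n).
  apply: le_trans (rho_sum _ _); last by [].
  rewrite big_nat_cond [leRHS]big_nat_cond; apply: lee_sum => i /andP[/andP[_ iN] _].
  have [x1 x2 xr _] := xP (n, i) iN; apply: le_trans xr.
  rewrite /g ge0_integralD //; last 2 first.
  + by apply/measurable_EFinP; apply: measurable_indic; exact: measurable_itv.
  + by apply/measurable_EFinP; apply: measurable_indic; exact: measurable_itv.
  rewrite !integral_indic //= ?setIT; try exact: measurable_itv.
  by rewrite /I1 /I2 !lebesgue_measure_segment.
- move=> u ts ts' uts uts' h1 h2.
  have [n1 hn1] := distinct_pieces ab uts (fun t tt => (h1 t tt).1).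
  have [n2 hn2] := distinct_pieces ab uts' (fun t tt => (h2 t tt).1).
  apply: (@limn_einf_ge _ _ _ (maxn n1 n2)) => n; rewrite geq_max => /andP[nn1 nn2].
  rewrite /f /g big_split /= !sumEFin -EFinD lee_fin natrD lerD //.
  + apply: hn1 => // i t iN tt pit; rewrite /I1 /= in_itv /=.
    have [_ _ _ h] := xP (n, i) iN; have [+ _] := h t pit.
    by have [_ ->] := h1 t tt.
  + apply: hn2 => // i t iN tt pit; rewrite /I2 /= in_itv /=.
    have [_ _ _ h] := xP (n, i) iN; have [_] := h t pit.
    by have [_ ->] := h2 t tt.
Qed.

End Banach.

Section Crofton.
Context {R : realType}.
Implicit Types (S : set (R * R)) (m : \bar R).

(** The sets S whose points on the coordinate lines can be counted by a
    function of integral at most m. For curves m is the length, but unlike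
    length this notion is obviously monotone and subadditive in S, and it does
    not mention parametrizations. *)
Definition crofton S m := exists M : R -> \bar R,
  [/\ measurable_fun setT M, (forall u, 0 <= M u)%E,
      (\int[lebesgue_measure]_u M u <= m)%E &
      forall u (zs zs' : seq R), uniq zs -> uniq zs' ->
        (forall z, z \in zs -> S (u, z)) -> (forall z, z \in zs' -> S (z, u)) ->
        ((size zs + size zs')%:R%:E <= M u)%E].

Lemma crofton_curve (l : R -> R * R) (a b : R) : a <= b ->
  {within `[a, b], continuous l} -> crofton (l @` `[a, b]) (rho a b l).
Proof.
move=> ab cl; have [M [mM M0 iM MP]] := banach_indicatrix ab cl.
exists M; split => // u zs zs' uzs uzs' h1 h2.
have /choice[g gP] : forall z, exists t, z \in zs -> a <= t <= b /\ l t = (u, z).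
  move=> z; have [/h1[t tab lt]|] := boolP (z \in zs); last by exists 0.
  by exists t; move: tab; rewrite /= in_itv.
have /choice[g' gP'] : forall z, exists t, z \in zs' -> a <= t <= b /\ l t = (z, u).
  move=> z; have [/h2[t tab lt]|] := boolP (z \in zs'); last by exists 0.
  by exists t; move: tab; rewrite /= in_itv.
rewrite -(size_map g zs) -(size_map g' zs'); apply: MP.
- rewrite map_inj_in_uniq // => s t /gP[_ ls] /gP[_ lt] st.
  by move: ls; rewrite st lt => -[].
- rewrite map_inj_in_uniq // => s t /gP'[_ ls] /gP'[_ lt] st.
  by move: ls; rewrite st lt => -[].
- by move=> _ /mapP[z /gP[h lz] ->]; rewrite lz.
- by move=> _ /mapP[z /gP'[h lz] ->]; rewrite lz.
Qed.

(** A finite subset of the union splits into a part in the first set and a part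
    in the second one. *)
Lemma croftonU S1 S2 m1 m2 : crofton S1 m1 -> crofton S2 m2 ->
  crofton (S1 `|` S2) (m1 + m2).
Proof.
move=> [M1 [mM1 M10 iM1 MP1]] [M2 [mM2 M20 iM2 MP2]].
exists (fun u => M1 u + M2 u)%E; split.
- exact: emeasurable_funD.
- by move=> u; rewrite adde_ge0.
- by rewrite ge0_integralD // leeD.
- move=> u zs zs' uzs uzs' h h'.
  pose p z := `[< S1 (u, z) >]; pose p' z := `[< S1 (z, u) >].
  have := MP1 u (seq.filter p zs) (seq.filter p' zs') (filter_uniq _ uzs) (filter_uniq _ uzs').
  have := MP2 u (seq.filter (predC p) zs) (seq.filter (predC p') zs')
    (filter_uniq _ uzs) (filter_uniq _ uzs').
  have i1 z : z \in seq.filter p zs -> S1 (u, z) by rewrite mem_filter => /andP[/asboolP].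
  have i2 z : z \in seq.filter p' zs' -> S1 (z, u) by rewrite mem_filter => /andP[/asboolP].
  have i3 z : z \in seq.filter (predC p) zs -> S2 (u, z).
    by rewrite mem_filter => /andP[/asboolP nS /h []].
  have i4 z : z \in seq.filter (predC p') zs' -> S2 (z, u).
    by rewrite mem_filter => /andP[/asboolP nS /h' []].
  move=> /(_ i3 i4) k2 /(_ i1 i2) k1; apply: le_trans (leeD k1 k2).
  rewrite -EFinD lee_fin -natrD ler_nat !size_filter.
  have := count_predC p zs; have := count_predC p' zs'; lia.
Qed.

Lemma crofton0 : crofton set0 0.
Proof.
exists (fun=> 0%E); split => //; first by rewrite integral0.
by move=> u [|z zs] [|z' zs'] //= _ _ h h'; [have := h' z'|have := h z|have := h z];
  rewrite inE eqxx => /(_ isT).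
Qed.

Lemma sub_crofton S S' m m' : S `<=` S' -> (m' <= m)%E -> crofton S' m' -> crofton S m.
Proof.
move=> SS mm [M [mM M0 iM MP]]; exists M; split=> //; first exact: le_trans mm.
by move=> u zs zs' uzs uzs' h h'; apply: MP => // z zz; apply: SS; [exact: h|exact: h'].
Qed.

Lemma crofton_curves (l : R -> R * R) (K : seq (R * R)) :
  (forall k, k \in K -> k.1 <= k.2 /\ {within `[k.1, k.2], continuous l}) ->
  crofton [set p | exists2 k, k \in K & (l @` `[k.1, k.2]) p]
    (\sum_(k <- K) rho k.1 k.2 l)%E.
Proof.
elim: K => [|k K IH] h.
  by rewrite big_nil; apply: sub_crofton crofton0 => // p [].
rewrite big_cons.
have [k12 cl] := h k (mem_head _ _).
apply: (sub_crofton _ _ (croftonU (crofton_curve k12 cl) (IH _))) => //.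
- move=> p [k']; rewrite inE => /orP[/eqP->|k'K] lp; first by left.
  by right; exists k'.
- by move=> k' k'K; apply: h; rewrite inE k'K orbT.
Qed.

End Crofton.

(** * Cutting arcs out of a curve *)

Section Gaps.
Context {R : realType}.
Implicit Types (l : R -> R * R) (a b : R).

Lemma disjoint_itv_order (s s' t t' : R) : s < s' -> t < t' ->
  [set` `]s, s'[] `&` [set` `]t, t'[] = set0 -> s' <= t \/ t' <= s.
Proof.
move=> ss tt h; have [|st] := leP s' t; first by left.
right; rewrite leNgt; apply/negP => ts.
pose x := (Num.max s t + Num.min s' t') / 2.
have [m1 m2] : Num.max s t < x /\ x < Num.min s' t'.
  have : Num.max s t < Num.min s' t' by rewrite gt_max !lt_min ss st tt ts.
  rewrite /x; lra.
have : ([set` `]s, s'[] `&` [set` `]t, t'[]) x.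
  move: m1 m2; rewrite gt_max lt_min => /andP[h1 h2] /andP[h3 h4].
  by split; rewrite /= in_itv /= ?h1 ?h2 ?h3 ?h4.
by rewrite h.
Qed.

(** What remains of [a, b] after removal of finitely many non-overlapping
    intervals is a finite union of intervals, and superadditivity of the length
    accounts for all the pieces. The induction removes one interval and
    separates the others into those on its left and those on its right. *)
Lemma complementary_gaps l (s s' : nat -> R) (X : seq nat) a b : a <= b -> uniq X ->
  (forall i, i \in X -> [/\ a <= s i, s i < s' i & s' i <= b]) ->
  (forall i j, i \in X -> j \in X -> i != j -> s' i <= s j \/ s' j <= s i) ->
  exists K : seq (R * R), [/\ forall k, k \in K -> [/\ a <= k.1, k.1 <= k.2 & k.2 <= b],
    (\sum_(i <- X) rho (s i) (s' i) l + \sum_(k <- K) rho k.1 k.2 l <= rho a b l)%E &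
    forall t, a <= t <= b -> (exists2 i, i \in X & s i <= t <= s' i) \/
      (exists2 k, k \in K & k.1 <= t <= k.2)].
Proof.
have [n] := ubnP (size X); elim: n X a b => // n IH [|j X] a b /=.
  move=> _ ab _ _ _; exists [:: (a, b)]; split.
  - by move=> k; rewrite inE => /eqP->; split.
  - by rewrite big_nil big_seq1 add0e.
  - by move=> t tab; right; exists (a, b) => //; rewrite inE.
move=> sX ab /andP[jX uX] h dis.
have [aj jj jb] := h j (mem_head _ _).
pose p i := s' i <= s j.
have hX i : i \in X -> [/\ a <= s i, s i < s' i & s' i <= b].
  by move=> iX; apply: h; rewrite inE iX orbT.
have disX i k : i \in X -> k \in X -> i != k -> s' i <= s k \/ s' k <= s i.
  by move=> iX kX; apply: dis; rewrite inE ?iX ?kX orbT.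
have right i : i \in X -> ~~ p i -> s' j <= s i.
  move=> iX /negP pi; have ij : j != i by apply: contraNneq jX => ->.
  have iX' : i \in j :: X by rewrite inE iX orbT.
  by have [] := dis j i (mem_head _ _) iX' ij.
have size_lt q : (size (seq.filter q X) < n)%N.
  by rewrite size_filter (leq_ltn_trans (count_size _ _)).
have [|||K1 [K1h K1r K1c]] := IH (seq.filter p X) a (s j) (size_lt _) aj.
- exact: filter_uniq.
- by move=> i; rewrite mem_filter => /andP[pi /hX[? ? ?]]; split.
- by move=> i k; rewrite !mem_filter => /andP[_ iX] /andP[_ kX]; exact: disX.
have [|||K2 [K2h K2r K2c]] := IH (seq.filter (predC p) X) (s' j) b (size_lt _) jb.
- exact: filter_uniq.
- by move=> i; rewrite mem_filter => /andP[pi iX]; have [? ? ?] := hX _ iX; split=> //; exact: right.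
- by move=> i k; rewrite !mem_filter => /andP[_ iX] /andP[_ kX]; exact: disX.
exists (K1 ++ K2); split.
- move=> k; rewrite mem_cat => /orP[/K1h[? ? ?]|/K2h[? ? ?]]; split => //.
    by apply: le_trans jb; apply: le_trans (ltW jj).
  by apply: (le_trans aj); apply: le_trans (ltW jj) _.
- have r1 := rho_superadditive l aj (ltW jj).
  have r2 := rho_superadditive l (le_trans aj (ltW jj)) jb.
  apply: le_trans r2; apply: le_trans (leeD r1 (lexx _)).
  apply: le_trans (leeD (leeD K1r (lexx _)) K2r).
  rewrite big_cons big_cat /= (bigID p) /= !big_filter.
  set A := (\sum_(i <- X | p i) _)%E; set B := (\sum_(i <- X | ~~ p i) _)%E.
  set C := (\sum_(i <- K1) _)%E; set D := (\sum_(i <- K2) _)%E.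
  by rewrite [(A + C + _)%E]addeC !addeA [X in (_ <= X + _)%E]addeAC.
- move=> t /andP[at_ tb].
  have [tj|jt] := leP t (s j).
    have [|[i]|[k kK tk]] := K1c t; first by rewrite at_ tj.
    + by rewrite mem_filter => /andP[_ iX] it; left; exists i => //; rewrite inE iX orbT.
    + by right; exists k => //; rewrite mem_cat kK.
  have [tj|jt'] := leP t (s' j).
    by left; exists j; rewrite ?inE ?eqxx // (ltW jt).
  have [|[i]|[k kK tk]] := K2c t; first by rewrite (ltW jt').
  + by rewrite mem_filter => /andP[_ iX] it; left; exists i => //; rewrite inE iX orbT.
  + by right; exists k => //; rewrite mem_cat kK orbT.
Qed.

End Gaps.

(** * Boundary points on a line *)

Section Lines.
Context {R : realType}.
Implicit Types (A B : set (R * R)) (f : R -> R * R).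

(** The supremum of the parameters in [p, q] that f maps into A is mapped to a
    boundary point. *)
Lemma exits_right A f p q : open A -> continuous f -> p < q -> A (f p) ->
  ~ A (f q) -> exists z, [/\ p < z, z <= q & topboundary A (f z)].
Proof.
move=> oA cf pq Ap nAq.
pose S := [set t | p <= t <= q /\ A (f t)].
have hS : has_sup S.
  split; first by exists p; rewrite /S /= lexx (ltW pq).
  by exists q => t [/andP[]].
have ub t : S t -> t <= sup S by move=> St; exact: (sup_upper_bound hS).
have zq : sup S <= q by apply: ge_sup; [case: hS|move=> t [/andP[]]].
have pz : p <= sup S by apply: ub; rewrite /S /= lexx (ltW pq).
have oAf : open (f @^-1` A) by apply: open_comp => // x _; exact: cf.
have nAz : ~ A (f (sup S)).
  move=> Az; have {}zq : sup S < q.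
    by rewrite lt_neqAle zq andbT; apply/eqP => zE; apply: nAq; rewrite -zE.
  have : nbhs (sup S) (f @^-1` A) by exact: open_nbhs_nbhs.
  move=> /nbhs_ballP[e /= e0 he].
  pose t := Num.min q (sup S + e / 2).
  have zt : sup S < t by rewrite /t lt_min zq ltrDl divr_gt0.
  have : t <= sup S.
    apply: ub; split; first by rewrite (le_trans pz (ltW zt)) /t ge_min lexx.
    apply: he; rewrite /ball /= ltr_norml.
    have : t <= sup S + e / 2 by rewrite /t ge_min lexx orbT.
    by have := e0; lra.
  by rewrite leNgt zt.
exists (sup S); split => //.
  by rewrite lt_neqAle pz andbT; apply/eqP => pE; apply: nAz; rewrite -pE.
split; last by move=> /interior_subset.
move=> U Uz; have : nbhs (sup S) (f @^-1` U) by exact: cf.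
move=> /nbhs_ballP[e /= e0 he].
have [t St zt] := sup_adherent e0 hS.
exists (f t); split; first by case: St.
apply: he; rewrite /ball /= ltr_norml; have := ub t St; have := e0; lra.
Qed.

Lemma exits_left A f p q : open A -> continuous f -> q < p -> A (f p) ->
  ~ A (f q) -> exists z, [/\ q <= z, z < p & topboundary A (f z)].
Proof.
move=> oA cf qp Ap nAq.
have [||||z [pz zq bz]] := @exits_right A (f \o -%R) (- p) (- q) oA.
- by move=> x; apply: continuous_comp; [exact: oppr_continuous|exact: cf].
- by rewrite ltrN2.
- by rewrite /= opprK.
- by rewrite /= opprK.
by exists (- z); split => //; [rewrite lerNr|rewrite ltrNl].
Qed.

Lemma boundary_on_both_sides A f y (M : R) : open A -> continuous f ->
  (forall z, A (f z) -> `|z| <= M) -> A (f y) ->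
  exists z0 z1, [/\ z0 < y, y < z1, topboundary A (f z0) & topboundary A (f z1)].
Proof.
move=> oA cf hM Ay.
have M1 : M < `|M + 1| by apply: lt_le_trans (ler_norm _); rewrite ltrDl.
have yM : -M <= y <= M by rewrite -ler_norml hM.
have n1 : ~ A (f (M + 1)) by move=> /hM; rewrite leNgt M1.
have n2 : ~ A (f (- (M + 1))) by move=> /hM; rewrite leNgt normrN M1.
have [yM1 yM2] : - (M + 1) < y /\ y < M + 1 by lra.
have [z0 [_ z0y b0]] := exits_left oA cf yM1 Ay n2.
have [z1 [yz1 _ b1]] := exits_right oA cf yM2 Ay n1.
by exists z0, z1.
Qed.

Lemma disjoint_boundary A B p : open B -> A `&` B = set0 -> B p -> ~ closure A p.
Proof.
move=> oB AB Bp /(_ B (open_nbhs_nbhs (conj oB Bp))) [q [Aq Bq]].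
by have : (A `&` B) q by []; rewrite AB.
Qed.

(** One boundary point before A, one between A and B, and one after B. *)
Lemma three_boundary_points A B f y1 y2 (M : R) : open A -> open B ->
  A `&` B = set0 -> continuous f ->
  (forall z, A (f z) -> `|z| <= M) -> (forall z, B (f z) -> `|z| <= M) ->
  A (f y1) -> B (f y2) -> y1 < y2 ->
  exists zs, [/\ uniq zs, size zs = 3%N &
    forall z, z \in zs -> (topboundary A `|` topboundary B) (f z)].
Proof.
move=> oA oB AB cf MA MB A1 B2 y12.
have [z0 [_ [z0y _ b0 _]]] := boundary_on_both_sides oA cf MA A1.
have [_ [z2 [_ yz2 _ b2]]] := boundary_on_both_sides oB cf MB B2.
have nA2 : ~ A (f y2) by move=> A2; have : (A `&` B) (f y2) by []; rewrite AB.
have [z1 [yz1 zy1 b1]] := exits_right oA cf y12 A1 nA2.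
have z1y : z1 < y2.
  rewrite lt_neqAle zy1 andbT; apply/eqP => zE.
  by have [] := b1; rewrite zE => /(disjoint_boundary oB AB B2).
exists [:: z0; z1; z2]; split => //.
  by rewrite /= !inE !negb_or !lt_eqF //; lra.
by move=> z; rewrite !inE => /or3P[] /eqP->; [left|left|right].
Qed.

(** A line meets the two boundaries at least twice if it meets one region, and
    three times if it meets both; a + b + (a || b) encodes 0, 2, 2 and 3. *)
Lemma line_count A B f (M : R) : open A -> open B ->
  A `&` B = set0 -> continuous f ->
  (forall z, A (f z) -> `|z| <= M) -> (forall z, B (f z) -> `|z| <= M) ->
  let a := `[< exists z, A (f z) >] in let b := `[< exists z, B (f z) >] in
  exists zs, [/\ uniq zs, size zs = (a + b + (a || b))%N &
    forall z, z \in zs -> (topboundary A `|` topboundary B) (f z)].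
Proof.
move=> oA oB AB cf MA MB /=.
case: asboolP => [[y1 A1]|nA]; case: asboolP => [[y2 B2]|nB] /=.
- have [y12|y21|yE] := ltgtP y1 y2.
  + exact: (three_boundary_points oA oB AB cf MA MB A1 B2 y12).
  + have BA : B `&` A = set0 by rewrite setIC.
    have [zs [uzs szs h]] := three_boundary_points oB oA BA cf MB MA B2 A1 y21.
    by exists zs; split => // z /h[]; [right|left].
  + have : (A `&` B) (f y1) by split; rewrite // yE.
    by rewrite AB.
- have [z0 [z1 [h0 h1 b0 b1]]] := boundary_on_both_sides oA cf MA A1.
  exists [:: z0; z1]; split => //; first by rewrite /= !inE lt_eqF //; lra.
  by move=> z; rewrite !inE => /orP[] /eqP->; left.
- have [z0 [z1 [h0 h1 b0 b1]]] := boundary_on_both_sides oB cf MB B2.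
  exists [:: z0; z1]; split => //; first by rewrite /= !inE lt_eqF //; lra.
  by move=> z; rewrite !inE => /orP[] /eqP->; right.
- by exists [::].
Qed.

Lemma vline_continuous (u : R) : continuous (fun y : R => (u, y)).
Proof. by move=> y; exact: (cvg_pair (cvg_cst _) cvg_id). Qed.

Lemma hline_continuous (u : R) : continuous (fun x : R => (x, u)).
Proof. by move=> x; exact: (cvg_pair cvg_id (cvg_cst _)). Qed.

Lemma no_boundary_between A f p q : open A -> continuous f -> A (f p) ->
  (forall t, Num.min p q <= t <= Num.max p q -> ~ topboundary A (f t)) -> A (f q).
Proof.
move=> oA cf Ap h; apply: contrapT => nA.
have [pq|qp|pq] := ltgtP p q.
- have [z [pz zq /h[]]] := exits_right oA cf pq Ap nA.
  by rewrite ge_min le_max (ltW pz) zq orbT.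
- have [z [pz zq /h[]]] := exits_left oA cf qp Ap nA.
  by rewrite ge_min le_max pz (ltW zq) orbT.
- by apply: nA; rewrite -pq.
Qed.

End Lines.

(** * Open sets of finite area *)

Section ProductMeasure.
Context {R : realType}.
Implicit Types (A B : set (R * R)).

(** Countably many products of intervals with rational centres and radii
    1 / (n + 1) cover an open set. *)
Lemma open_measurable2 A : open A -> measurable (A : set (measurableTypeR R * measurableTypeR R)).
Proof.
move=> oA.
pose box (p q : rat) (n : nat) : set (R * R) :=
  `]ratr p - n.+1%:R^-1, ratr p + n.+1%:R^-1[%classic `*`
  `]ratr q - n.+1%:R^-1, ratr q + n.+1%:R^-1[%classic.
pose F p q n : set (R * R) := [set x | box p q n x /\ box p q n `<=` A].
have FE p q n : measurable (F p q n : set (measurableTypeR R * measurableTypeR R)).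
  have [h|h] := pselect (box p q n `<=` A).
    rewrite (_ : F p q n = box p q n); first exact: measurableX.
    by apply/seteqP; split=> [x []|x].
  by rewrite (_ : F p q n = set0) //; apply/seteqP; split=> [x []|x].
have -> : A = \bigcup_p \bigcup_q \bigcup_n F p q n.
  apply/seteqP; split; last by move=> x [p _ [q _ [n _ [bx]]]]; exact.
  move=> [x y] Axy.
  have [/= e e0 he] : exists2 e : R, 0 < e & forall x' y', `|x - x'| < e -> `|y - y'| < e -> A (x', y').
    have /nbhs_ballP[e /= e0 he] : nbhs (x, y) A by exact: open_nbhs_nbhs.
    by exists e => // x' y' hx hy; apply: he.
  have [n [r [rE r0 re]]] : exists n (r : R), [/\ r = n.+1%:R^-1, 0 < r & r < e / 2].
    exists (Num.trunc (2 / e)), (Num.trunc (2 / e)).+1%:R^-1; split => //.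
    rewrite -[ltRHS]invrK ltf_pV2 ?posrE ?invr_gt0 ?divr_gt0 // invfM invrK mulrC.
    exact: truncnS_gt.
  have [|p] := @rat_in_itvoo R (x - r) (x + r); first lra.
  have [|q] := @rat_in_itvoo R (y - r) (y + r); first lra.
  rewrite !in_itv /= => /andP[q1 q2] /andP[p1 p2].
  exists p => //; exists q => //; exists n => //; rewrite /F /box -rE; split.
    by split; rewrite /= in_itv /=; apply/andP; split; lra.
  move=> [x' y'] [/=]; rewrite !in_itv /= => /andP[x1 x2] /andP[y1 y2].
  apply: he; rewrite ltr_norml; apply/andP; split; lra.
apply: bigcupT_measurable_rat => p; apply: bigcupT_measurable_rat => q.
exact: bigcupT_measurable.
Qed.

Lemma mu2_rect (P Q : set R) : measurable (P : set (measurableTypeR R)) ->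
  measurable (Q : set (measurableTypeR R)) ->
  mu2 (P `*` Q) = (lebesgue_measure P * lebesgue_measure Q)%E.
Proof. exact: product_measure1E. Qed.

Lemma mu2_halfplane (M : R) : mu2 [set p : R * R | M < p.2] = +oo%E.
Proof.
have -> : [set p : R * R | M < p.2] = setT `*` `]M, +oo[%classic.
  by apply/seteqP; split=> [p h|p [_]]; rewrite /= ?in_itv /= ?andbT //; split=> //=; rewrite in_itv /= h.
rewrite mu2_rect //.
by rewrite -set_itvNyy !lebesgue_measure_itv /= ltry addye // addye // mulyy.
Qed.

Lemma le_mu2 A B : open A -> measurable (B : set (measurableTypeR R * measurableTypeR R)) ->
  A `<=` B -> (mu2 A <= mu2 B)%E.
Proof.
move=> oA mB AB; apply: le_measure => //; rewrite inE //; exact: open_measurable2.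
Qed.

(** From a point of A outside the square that contains the boundary one can
    move along horizontal and vertical lines without meeting the boundary, so
    A would contain a half plane. *)
Lemma bounded_of_finite_area A (M : R) : open A -> (mu2 A < +oo)%E ->
  (forall p, topboundary A p -> `|p.1| <= M /\ `|p.2| <= M) ->
  forall p, A p -> `|p.1| <= M /\ `|p.2| <= M.
Proof.
move=> oA fA bA.
have M1 : M < `|M + 1| by apply: lt_le_trans (ler_norm _); rewrite ltrDl.
have vert x y y' : M < `|x| -> A (x, y) -> A (x, y').
  move=> Mx Axy; apply: (no_boundary_between oA (@vline_continuous R x) Axy) => t _.
  by move=> /bA[/=]; rewrite leNgt Mx.
have hor x x' y : M < `|y| -> A (x, y) -> A (x', y).
  move=> Mx Axy; apply: (no_boundary_between oA (@hline_continuous R y) Axy) => t _.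
  by move=> /bA[_ /=]; rewrite leNgt Mx.
have outer x y : M < `|x| -> ~ A (x, y).
  move=> Mx Axy; move: fA; rewrite ltNge => /negP; apply.
  rewrite -(mu2_halfplane M); apply: le_measure.
  - by rewrite inE; apply: open_measurable2;
      apply: (@open_comp _ _ snd [set y | M < y]); [move=> ? _; exact: cvg_snd|exact: open_gt].
  - by rewrite inE; exact: open_measurable2.
  - move=> [x' y'] /= My'; apply: (hor x); first exact: lt_le_trans (ler_norm _).
    exact: vert Axy.
move=> [x y] Axy /=; split; rewrite leNgt; apply/negP => h.
  exact: outer Axy.
by apply: (outer (M + 1) y) => //; exact: hor Axy.
Qed.

End ProductMeasure.

(** * The lower bound *)

Section LowerBound.
Context {R : realType}.
Implicit Types (A B : set (R * R)).

Definition xproj A : set R := [set u | exists z, A (u, z)].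
Definition yproj A : set R := [set u | exists z, A (z, u)].

Lemma open_xproj A : open A -> open (xproj A).
Proof.
move=> oA; rewrite (_ : xproj A = \bigcup_z [set u | A (u, z)]).
  apply: bigcup_open => z _.
  by apply: (@open_comp _ _ (fun u => (u, z)) A) => // u _; exact: hline_continuous.
by apply/seteqP; split => [u [z]|u [z _]]; exists z.
Qed.

Lemma open_yproj A : open A -> open (yproj A).
Proof.
move=> oA; rewrite (_ : yproj A = \bigcup_z [set u | A (z, u)]).
  apply: bigcup_open => z _.
  by apply: (@open_comp _ _ (fun u => (z, u)) A) => // u _; exact: vline_continuous.
by apply/seteqP; split => [u [z]|u [z _]]; exists z.
Qed.

Lemma xprojU A B : xproj (A `|` B) = xproj A `|` xproj B.
Proof.
apply/seteqP; split => [u [z []]|u [[z]|[z]]] h; [left|right| |]; exists z => //.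
  by left.
by right.
Qed.

Lemma yprojU A B : yproj (A `|` B) = yproj A `|` yproj B.
Proof.
apply/seteqP; split => [u [z []]|u [[z]|[z]]] h; [left|right| |]; exists z => //.
  by left.
by right.
Qed.

Definition half_perimeter A : \bar R :=
  (lebesgue_measure (xproj A) + lebesgue_measure (yproj A))%E.

Lemma indic_asbool (P : set R) u : \1_P u = (`[< P u >])%:R :> R.
Proof.
by rewrite indicE; congr (_%:R).
Qed.

(** Integrate the bound of [line_count] over all vertical and horizontal lines. *)
Lemma half_perimeters_le_crofton A B (M : R) (m : \bar R) : open A -> open B ->
  A `&` B = set0 ->
  (forall p, A p -> `|p.1| <= M /\ `|p.2| <= M) ->
  (forall p, B p -> `|p.1| <= M /\ `|p.2| <= M) ->
  crofton (topboundary A `|` topboundary B) m ->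
  (half_perimeter A + half_perimeter B + half_perimeter (A `|` B) <= m)%E.
Proof.
move=> oA oB AB MA MB [N [mN N0 iN NP]]; apply: le_trans iN.
pose E := nth set0 [:: xproj A; yproj A; xproj B; yproj B;
  xproj (A `|` B); yproj (A `|` B)].
have oAB : open (A `|` B) by exact: openU.
have mE i : measurable (E i : set (measurableTypeR R)).
  rewrite /E; move: i; do 6 (case; first by apply: open_measurable;
    (exact: open_xproj || exact: open_yproj)).
  by move=> i; rewrite /= nth_nil.
have -> : (half_perimeter A + half_perimeter B + half_perimeter (A `|` B) =
    \sum_(0 <= i < 6) lebesgue_measure (E i))%E.
  by rewrite !big_nat_recr //= big_geq //= add0e /E /half_perimeter /= !addeA.
under eq_bigr do rewrite -[E _]setIT -(integral_indic _ measurableT) //.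
rewrite -ge0_integral_sum //; last first.
  by move=> i; apply/measurable_EFinP; exact: measurable_indic.
apply: ge0_le_integral => //.
- by move=> u _; apply: sume_ge0 => i _; rewrite lee_fin.
- by apply: emeasurable_sum => i; apply/measurable_EFinP; exact: measurable_indic.
move=> u _.
have [zs [uzs szs hzs]] := line_count oA oB AB (@vline_continuous R u)
  (fun z Az => (MA (u, z) Az).2) (fun z Bz => (MB (u, z) Bz).2).
have [zs' [uzs' szs' hzs']] := line_count oA oB AB (@hline_continuous R u)
  (fun z Az => (MA (z, u) Az).1) (fun z Bz => (MB (z, u) Bz).1).
apply: le_trans (NP u zs zs' uzs uzs' hzs hzs').
rewrite sumEFin lee_fin szs szs' !big_nat_recr //= big_geq //= add0r.
rewrite /E /= !indic_asbool xprojU yprojU.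
have aU (P Q : set R) : `[< (P `|` Q) u >] = `[< P u >] || `[< Q u >].
  exact: asbool_or.
rewrite !aU -!natrD ler_nat /xproj /yproj /=; lia.
Qed.

Lemma boundary_curve_bounded A (l : R -> R * R) : boundary_curve A l ->
  exists2 M : R, 0 <= M & forall p, topboundary A p -> `|p.1| <= M /\ `|p.2| <= M.
Proof.
move=> [cl _ _ Al].
have [x [_ _ _ h]] := box_le_rho ler01 cl.
exists (`|x.1.1| + `|x.1.2| + `|x.2.1| + `|x.2.2|); first by rewrite !addr_ge0.
move=> p; rewrite Al => -[t /=]; rewrite in_itv /= => /h[/andP[a1 a2] /andP[a3 a4]] <-.
have := ler_norm x.1.2; have := ler_norm x.2.2.
have := ler_norm (- x.1.1); have := ler_norm (- x.2.1); rewrite !normrN.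
have := normr_ge0 x.1.1; have := normr_ge0 x.1.2.
have := normr_ge0 x.2.1; have := normr_ge0 x.2.2.
by move=> *; split; rewrite ler_norml; apply/andP; split; lra.
Qed.

(** The arcs indexed by X lie on the second curve, so they can be cut out of the
    first one without uncovering a boundary point. This accounts for the
    subtraction of the common length in the perimeter of the pair. *)
Lemma crofton_boundaries A B (l l' : R -> R * R) (D : set nat) (s s' : nat -> R)
    (X : seq nat) : boundary_curve A l -> boundary_curve B l' ->
  arc_decomposition l l' D s s' -> uniq X -> (forall i, i \in X -> D i) ->
  exists2 m, crofton (topboundary A `|` topboundary B) m &
    (\sum_(i <- X) rho (s i) (s' i) l + m <= rho 0 1 l + rho 0 1 l')%E.
Proof.
move=> [cl _ _ Al] [cl' _ _ Bl] [hs dis cover] uX XD.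
have [||||K [Kh Kr Kc]] := @complementary_gaps R l s s' X 0 1.
- exact: ler01.
- exact: uX.
- by move=> i /XD/hs.
- move=> i j iX jX ij; apply: disjoint_itv_order.
  + by have [] := hs i (XD i iX).
  + by have [] := hs j (XD j jX).
  + have /trivIsetP := dis; apply => //; exact: XD.
exists (\sum_(k <- K) rho k.1 k.2 l + rho 0 1 l')%E; last first.
  by rewrite addeA leeD2r.
have cK : crofton [set p | exists2 k, k \in K & (l @` `[k.1, k.2]) p]
    (\sum_(k <- K) rho k.1 k.2 l)%E.
  apply: crofton_curves => k /Kh[k0 kk k1]; split => //.
  by apply: continuous_subspaceW cl; apply: subset_itv; rewrite bnd_simp.
apply: (sub_crofton _ _ (croftonU cK (crofton_curve ler01 cl'))) => //.
move=> p [|]; rewrite ?Al ?Bl; last by right.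
move=> [t /=]; rewrite in_itv /= => /Kc[[i iX it]|[k kK kt]] <-.
- right; have : nontrivial_intersection l l' (l t).
    by rewrite -cover; exists i; [exact: XD|exists t].
  move=> [[q q'] /= [_ _ _ [w [w' [w0 _ w1 eqw]]]]] lt.
  have : (l' @` `[w, w']) (l t) by rewrite -eqw.
  move=> [r /=]; rewrite in_itv /= => /andP[r1 r2] <-; exists r => //=; rewrite in_itv /=.
  by rewrite (le_trans w0 r1) (le_trans r2 w1).
- by left; exists k => //; exists t.
Qed.

(** The length of the common arcs is a supremum of finite sums, so it is enough
    to subtract finitely many of them. *)
Lemma half_perimeters_le_rhoDB A B (l l' : R -> R * R) (c : \bar R) (v : R) (G : \bar R) :
  boundary_curve A l -> boundary_curve B l' -> is_rho_cap l l' c ->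
  v%:E = (rho 0 1 l + rho 0 1 l' - c)%E -> (0 <= G)%E ->
  (forall m, crofton (topboundary A `|` topboundary B) m -> (G <= m)%E) ->
  (G <= v%:E)%E.
Proof.
move=> bl bl' [D [s [s' [arc cE]]]] vE G0 hG.
have rl := rho_ge0 l ler01; have rl' := rho_ge0 l' ler01.
have fl : rho 0 1 l \is a fin_num by rewrite ge0_fin_numE //; have [] := bl.
have fl' : rho 0 1 l' \is a fin_num by rewrite ge0_fin_numE //; have [] := bl'.
have key (X : seq nat) : uniq X -> (forall i, i \in X -> D i) ->
    (\sum_(i <- X) rho (s i) (s' i) l + G <= rho 0 1 l + rho 0 1 l')%E.
  move=> uX XD.
  have [m cm] := crofton_boundaries bl bl' arc uX XD.
  by apply: le_trans; rewrite leeD2l // hG.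
have Gfin : G \is a fin_num.
  have key0 : (G <= rho 0 1 l + rho 0 1 l')%E.
    by have := key [::]; rewrite big_nil add0e; apply.
  rewrite ge0_fin_numE //; apply: le_lt_trans key0 _.
  by rewrite ltey_eq fin_numD fl fl'.
have cG : (c <= rho 0 1 l + rho 0 1 l' - G)%E.
  rewrite cE; apply: ge_ereal_sup => _ [F [finF FD] <-].
  rewrite fsbig_finite //= leeBrDr //; apply: key; first exact: finmap.fset_uniq.
  by move=> i; rewrite in_fset_set // => /set_mem/FD.
rewrite vE.
have fin : (rho 0 1 l + rho 0 1 l')%E \is a fin_num by rewrite fin_numD fl fl'.
have c0 : (0 <= c)%E.
  rewrite cE; apply: esum_ge0 => i Di; apply: rho_ge0.
  by have [hs _ _] := arc; have [_ /ltW] := hs i Di.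
have fc : c \is a fin_num.
  rewrite ge0_fin_numE //; apply: (le_lt_trans cG).
  by rewrite ltey_eq fin_numB fin Gfin.
by rewrite leeBrDr // addeC -leeBrDr.
Qed.

Lemma lebesgue_measure_bounded (P : set R) (M : R) : 0 <= M ->
  measurable (P : set (measurableTypeR R)) -> (forall u, P u -> `|u| <= M) ->
  exists2 w : R, 0 <= w & lebesgue_measure P = w%:E.
Proof.
move=> M0 mP PM.
have fP : lebesgue_measure P \is a fin_num.
  rewrite ge0_fin_numE //; apply: (@le_lt_trans _ _ (lebesgue_measure `[-M, M]%classic)).
    apply: le_measure; [exact: mem_set|apply: mem_set; exact: measurable_itv|].
    by move=> u /PM; rewrite ler_norml /= in_itv.
  by rewrite lebesgue_measure_segment ?ltry //; lra.
exists (fine (lebesgue_measure P)); first by rewrite fine_ge0.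
by rewrite fineK.
Qed.

Lemma overlap_lengths (P Q : set R) (M : R) : 0 <= M ->
  measurable (P : set (measurableTypeR R)) ->
  measurable (Q : set (measurableTypeR R)) ->
  (forall u, P u -> `|u| <= M) -> (forall u, Q u -> `|u| <= M) ->
  exists p q e : R, [/\ [/\ 0 <= p, 0 <= q, 0 <= e, e <= p & e <= q],
    lebesgue_measure P = p%:E, lebesgue_measure Q = q%:E,
    lebesgue_measure (P `&` Q) = e%:E &
    lebesgue_measure (P `|` Q) = (p + q - e)%:E].
Proof.
move=> M0 mP mQ PM QM.
have [p p0 pE] := lebesgue_measure_bounded M0 mP PM.
have [q q0 qE] := lebesgue_measure_bounded M0 mQ QM.
have mPQ : measurable (P `&` Q : set (measurableTypeR R)) by exact: measurableI.
have [e e0 eE] := lebesgue_measure_bounded M0 mPQ (fun u h => PM u h.1).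
exists p, q, e; split => //.
  by split => //; rewrite -lee_fin -eE -?pE -?qE; apply: le_measure;
    try exact: mem_set; [exact: subIsetl|exact: subIsetr].
have -> : (p + q - e)%:E = (lebesgue_measure P + lebesgue_measure Q
    - lebesgue_measure (P `&` Q))%E by rewrite pE qE eE.
by apply: measureUfinr => //; rewrite [ltLHS]qE ltry.
Qed.

Lemma mu2U A B : measurable (A : set (measurableTypeR R * measurableTypeR R)) ->
  measurable (B : set (measurableTypeR R * measurableTypeR R)) ->
  A `&` B = set0 -> mu2 (A `|` B) = (mu2 A + mu2 B)%E.
Proof. by move=> *; exact: measureU. Qed.

Lemma mu2UI A B : measurable (A : set (measurableTypeR R * measurableTypeR R)) ->
  measurable (B : set (measurableTypeR R * measurableTypeR R)) ->
  (mu2 B < +oo)%E -> mu2 (A `|` B) = (mu2 A + mu2 B - mu2 (A `&` B))%E.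
Proof. by move=> *; exact: measureUfinr. Qed.

(** A, B and their union are covered by products of their shadows, whose
    areas and overlaps are those of two boxes. *)
Theorem min_perim_le_rhoDB (al : R) A B (v : R) : 0 < al -> al <= 1 ->
  gamma al A B -> is_rhoDB A B v -> min_perim al <= v.
Proof.
move=> al0 al1 [AB [oA _ [lA blA]] [oB _ [lB blB]] _ [muA muB]].
move=> [l [l' [c [bl bl' cap vE]]]].
have [MA MA0 bA] := boundary_curve_bounded blA.
have [MB MB0 bB] := boundary_curve_bounded blB.
pose M := MA + MB; have M0 : 0 <= M by rewrite addr_ge0.
have bdA p : A p -> `|p.1| <= M /\ `|p.2| <= M.
  move=> /(bounded_of_finite_area oA _ bA); rewrite muA ltry => /(_ isT)[h1 h2].
  by split; rewrite (le_trans h1, le_trans h2) // lerDl.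
have bdB p : B p -> `|p.1| <= M /\ `|p.2| <= M.
  move=> /(bounded_of_finite_area oB _ bB); rewrite muB ltry => /(_ isT)[h1 h2].
  by split; rewrite (le_trans h1, le_trans h2) // lerDr.
have oPA := open_xproj oA; have oPB := open_xproj oB.
have oQA := open_yproj oA; have oQB := open_yproj oB.
have [a [c' [e [[a0 c0 e0 ea ec] PA PB PI PU]]]] := overlap_lengths M0
  (open_measurable oPA) (open_measurable oPB)
  (fun u (h : xproj A u) => let: ex_intro z Az := h in (bdA _ Az).1)
  (fun u (h : xproj B u) => let: ex_intro z Bz := h in (bdB _ Bz).1).
have [b [d [f [[b0 d0 f0 fb fd] QA QB QI QU]]]] := overlap_lengths M0
  (open_measurable oQA) (open_measurable oQB)
  (fun u (h : yproj A u) => let: ex_intro z Az := h in (bdA _ Az).2)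
  (fun u (h : yproj B u) => let: ex_intro z Bz := h in (bdB _ Bz).2).
have G0 : (0 <= half_perimeter A + half_perimeter B + half_perimeter (A `|` B))%E.
  by rewrite !adde_ge0.
have := half_perimeters_le_rhoDB bl bl' cap vE G0
  (fun m => half_perimeters_le_crofton oA oB AB bdA bdB).
rewrite /half_perimeter xprojU yprojU PA PB PU QA QB QU -!EFinD lee_fin.
move=> Gv; apply: le_trans (_ : 2 * (a + b + c' + d) - e - f <= v); last by lra.
have mPA := open_measurable oPA; have mPB := open_measurable oPB.
have mQA := open_measurable oQA; have mQB := open_measurable oQB.
have mRA : measurable (xproj A `*` yproj A : set (measurableTypeR R * measurableTypeR R)).
  exact: measurableX.
have mRB : measurable (xproj B `*` yproj B : set (measurableTypeR R * measurableTypeR R)).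
  exact: measurableX.
have sA : A `<=` xproj A `*` yproj A by move=> [x y] Axy; split; [exists y|exists x].
have sB : B `<=` xproj B `*` yproj B by move=> [x y] Axy; split; [exists y|exists x].
have rA : mu2 (xproj A `*` yproj A) = (a * b)%:E by rewrite mu2_rect // PA QA.
have rB : mu2 (xproj B `*` yproj B) = (c' * d)%:E by rewrite mu2_rect // PB QB.
apply: two_boxes_min_perim => //.
- by rewrite -lee_fin -muA -rA; exact: le_mu2.
- by rewrite -lee_fin -muB -rB; exact: le_mu2.
- have mA := open_measurable2 oA; have mB := open_measurable2 oB.
  have muAB : mu2 (A `|` B) = (1 + al)%:E by rewrite mu2U // muA muB.
  have rI : mu2 ((xproj A `*` yproj A) `&` (xproj B `*` yproj B)) = (e * f)%:E.
    by rewrite -setXI mu2_rect ?PI ?QI //; exact: measurableI.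
  have rU : mu2 ((xproj A `*` yproj A) `|` (xproj B `*` yproj B)) =
      (a * b + c' * d - e * f)%:E.
    by rewrite mu2UI // ?rA ?rB ?rI ?ltry.
  rewrite -lee_fin -rU -muAB; apply: le_mu2; first exact: openU.
    exact: measurableU.
  by move=> p [/sA|/sB]; [left|right].
Qed.

End LowerBound.

(** * Star-shaped sets are simply connected *)

Section Continuity.
Context {R : realType} {T : topologicalType}.
Implicit Types f g : T -> R.

Lemma continuous_addf f g : continuous f -> continuous g ->
  continuous (fun x => f x + g x).
Proof. by move=> cf cg x; apply: cvgD; [exact: cf|exact: cg]. Qed.

Lemma continuous_subf f g : continuous f -> continuous g ->
  continuous (fun x => f x - g x).
Proof. by move=> cf cg x; apply: cvgB; [exact: cf|exact: cg]. Qed.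

Lemma continuous_mulf f g : continuous f -> continuous g ->
  continuous (fun x => f x * g x).
Proof. by move=> cf cg x; apply: cvgM; [exact: cf|exact: cg]. Qed.

Lemma continuous_maxf f g : continuous f -> continuous g ->
  continuous (fun x => Num.max (f x) (g x)).
Proof. by move=> cf cg x; apply: continuous_max; [exact: cf|exact: cg]. Qed.

Lemma continuous_minf f g : continuous f -> continuous g ->
  continuous (fun x => Num.min (f x) (g x)).
Proof. by move=> cf cg x; apply: continuous_min; [exact: cf|exact: cg]. Qed.

Lemma continuous_pairf f g : continuous f -> continuous g ->
  continuous (fun x => (f x, g x)).
Proof. by move=> cf cg x; exact: (cvg_pair (cf x) (cg x)). Qed.

End Continuity.

(** The truncation of x to [0, w]. A closed polygonal path with axis-parallel
    sides, parametrized by arc length, is a signed sum of such ramps, one for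
    each side. *)
Definition clamp {R : realType} (w x : R) : R := Num.max 0 (Num.min w x).

Section Star.
Context {R : realType}.
Implicit Types (A : set (R * R)) (l : R -> R * R).

Lemma continuous_clamp {T : topologicalType} (w : R) (f : T -> R) :
  continuous f -> continuous (fun x => clamp w (f x)).
Proof.
move=> cf; apply: continuous_maxf; first by move=> ?; exact: cvg_cst.
by apply: continuous_minf => // ?; exact: cvg_cst.
Qed.

Lemma clamp_spec (w x : R) : 0 <= w ->
  [\/ x <= 0 /\ clamp w x = 0, 0 <= x <= w /\ clamp w x = x
    | w <= x /\ clamp w x = w].
Proof.
move=> w0; rewrite /clamp; have [xw|wx] := leP x w.
  have [x0|x0] := leP 0 x; first by constructor 2; rewrite ?x0.
  by constructor 1; rewrite ltW.
by constructor 3; rewrite (ltW wx) max_r.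
Qed.

(** A curve is continuous only within [0, 1]; stopping it at both ends gives a
    continuous map on the whole line. *)
Lemma continuous_curve_clamp l : curve l -> continuous (fun t => l (clamp 1 t)).
Proof.
move=> /subspace_continuousP cl x U; set y := clamp 1 x => Uy.
have y01 : y \in `[0, 1]%R.
  rewrite in_itv /= /y.
  by have [[_ ->]|[h ->]|[_ ->]] := clamp_spec x (@ler01 R); rewrite ?lexx ?ler01.
have := cl y y01 U Uy; rewrite /within /= => nU.
have cx : continuous (fun t : R => clamp 1 t).
  by apply: continuous_clamp => t; exact: cvg_id.
have nV : \forall s \near x, clamp 1 s \in `[0, 1]%R -> U (l (clamp 1 s)) := cx x _ nU.
suff : \forall s \near x, U (l (clamp 1 s)) by [].
apply: filterS nV => s; apply.
rewrite /= in_itv /=.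
by have [[_ ->]|[h ->]|[_ ->]] := clamp_spec s (@ler01 R); rewrite ?lexx ?ler01.
Qed.

Definition homothety (c : R * R) (r : R) (p : R * R) : R * R :=
  (c.1 + r * (p.1 - c.1), c.2 + r * (p.2 - c.2)).

Definition star_shaped A (c : R * R) :=
  forall p r, A p -> 0 <= r <= 1 -> A (homothety c r p).

(** The centre c plus a multiple of p - c plus a multiple of q - c. Contractions
    towards c and motions along a segment from c are both of this form, and two
    of them can be glued by letting the coefficients vary. *)
Definition two_rays (c : R * R) (a : R) (p : R * R) (b : R) (q : R * R) : R * R :=
  (c.1 + a * (p.1 - c.1) + b * (q.1 - c.1), c.2 + a * (p.2 - c.2) + b * (q.2 - c.2)).

Lemma continuous_two_rays {T : topologicalType} c (a b : T -> R) (p q : T -> R * R) :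
  continuous a -> continuous b -> continuous p -> continuous q ->
  continuous (fun x => two_rays c (a x) (p x) (b x) (q x)).
Proof.
move=> ca cb cp cq.
have cc (k : R) : continuous (fun _ : T => k) by move=> ?; exact: cvg_cst.
have c1 (h : T -> R * R) : continuous h -> continuous (fun x => (h x).1).
  by move=> ch x; apply: cvg_comp (ch x) _; exact: cvg_fst.
have c2 (h : T -> R * R) : continuous h -> continuous (fun x => (h x).2).
  by move=> ch x; apply: cvg_comp (ch x) _; exact: cvg_snd.
apply: continuous_pairf; apply: continuous_addf.
- apply: continuous_addf => //.
  by apply: continuous_mulf => //; apply: continuous_subf => //; exact: c1.
- by apply: continuous_mulf => //; apply: continuous_subf => //; exact: c1.
- apply: continuous_addf => //.
  by apply: continuous_mulf => //; apply: continuous_subf => //; exact: c2.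
- by apply: continuous_mulf => //; apply: continuous_subf => //; exact: c2.
Qed.

Lemma two_raysl c a p q : two_rays c a p 0 q = homothety c a p.
Proof. by rewrite /two_rays !mul0r !addr0. Qed.

Lemma two_raysr c b p q : two_rays c 0 p b q = homothety c b q.
Proof. by rewrite /two_rays !mul0r !addr0. Qed.

Lemma two_rays_same c a b p : two_rays c a p b p = homothety c (a + b) p.
Proof. by rewrite /two_rays /homothety !mulrDl !addrA. Qed.

Lemma homothety1 c p : homothety c 1 p = p.
Proof. by case: p => x y; rewrite /homothety /= !mul1r !subrKC. Qed.

(** A loop has to be contracted with its base point fixed, while the obvious
    contraction to c moves it. So the loop is first reparametrized to rest at
    the base point during the first and the last third of the time (phi); then
    it is contracted to c on the middle third, the outer thirds running between
    the base point and c (the coefficient m); finally the whole is pulled back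
    along the segment from c to the base point. The functions tau 0, tau 1 and
    tau 2 switch these three stages on one after the other. *)
Lemma star_shaped_simply_connected A c : star_shaped A c -> simply_connected A.
Proof.
move=> sA; split.
- move=> p q Ap Aq.
  pose a (t : R) := Num.max 0 (1 - 2 * t); pose b (t : R) := Num.max 0 (2 * t - 1).
  have cid : continuous (fun t : R => 2 * t).
    by apply: continuous_mulf => t; [exact: cvg_cst|exact: cvg_id].
  exists (fun t => two_rays c (a t) p (b t) q); split.
  + apply: continuous_subspaceT; apply: continuous_two_rays.
    * by apply: continuous_maxf; [|apply: continuous_subf] => // ?; exact: cvg_cst.
    * by apply: continuous_maxf; [|apply: continuous_subf] => // ?; exact: cvg_cst.
    * by move=> ?; exact: cvg_cst.
    * by move=> ?; exact: cvg_cst.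
  + move=> z [t /=]; rewrite in_itv /= => /andP[t0 t1] <-.
    have [h|h] := leP t (1 / 2).
      have -> : b t = 0 by rewrite /b max_l //; lra.
      rewrite two_raysl; apply: sA => //; rewrite /a max_r; lra.
    have -> : a t = 0 by rewrite /a max_l //; lra.
    rewrite two_raysr; apply: sA => //; rewrite /b max_r; lra.
  + rewrite (_ : b 0 = 0) ?two_raysl; last by rewrite /b max_l //; lra.
    by rewrite (_ : a 0 = 1) ?homothety1 // /a max_r; lra.
  + rewrite (_ : a 1 = 0) ?two_raysr; last by rewrite /a max_l //; lra.
    by rewrite (_ : b 1 = 1) ?homothety1 // /b max_r; lra.
- move=> l cl lA l01.
  pose m s : R := clamp 1 (Num.min (3 * s) (3 - 3 * s)).
  pose phi s : R := clamp 1 (3 * s - 1).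
  pose tau k t : R := clamp 1 (3 * t - k).
  pose th (x : R * R) := (1 - tau 0 x.2) * x.1 + tau 0 x.2 * phi x.1.
  pose L t := l (clamp 1 t).
  exists (fun x => two_rays c (1 - tau 1 x.2 * m x.1) (L (th x)) (tau 2 x.2 * m x.1) (l 0)).
  have cc (T : topologicalType) (k : R) : continuous (fun _ : T => k) by move=> ?; exact: cvg_cst.
  have c1 : continuous (fun x : R * R => x.1) by move=> x; exact: cvg_fst.
  have c2 : continuous (fun x : R * R => x.2) by move=> x; exact: cvg_snd.
  have c31 : continuous (fun x : R * R => 3 * x.1) by exact: continuous_mulf.
  have c32 : continuous (fun x : R * R => 3 * x.2) by exact: continuous_mulf.
  have cm : continuous (fun x : R * R => m x.1).
    by apply: continuous_clamp; apply: continuous_minf => //; exact: continuous_subf.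
  have cphi : continuous (fun x : R * R => phi x.1).
    by apply: continuous_clamp; exact: continuous_subf.
  have ctau k : continuous (fun x : R * R => tau k x.2).
    by apply: continuous_clamp; exact: continuous_subf.
  have cth : continuous th.
    apply: continuous_addf; apply: continuous_mulf => //.
    exact: continuous_subf.
  have cL : continuous (fun x => L (th x)).
    by move=> x; apply: continuous_comp; [exact: cth|exact: continuous_curve_clamp].
  have LA t : A (L t).
    apply: lA; exists (clamp 1 t) => //=; rewrite in_itv /=.
    by have [[_ ->]|[h ->]|[_ ->]] := clamp_spec t (@ler01 R); rewrite ?lexx ?ler01.
  have Lid t : 0 <= t <= 1 -> L t = l t.
    rewrite /L => t01; congr l; have [[h ->]|[h ->]|[h ->]] := clamp_spec t (@ler01 R); lra.
  have A0 : A (l 0) by rewrite -Lid ?lexx ?ler01.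
  (* where the contraction is incomplete the loop rests at its base point *)
  have rest s : 0 <= s <= 1 -> [/\ 0 <= m s, m s <= 1 & m s = 1 \/ L (phi s) = l 0].
    move=> s01; rewrite /m; set y := Num.min _ _.
    have y1 : y <= 3 * s by rewrite /y ge_min lexx.
    have y2 : y <= 3 - 3 * s by rewrite /y ge_min lexx orbT.
    have y3 : 3 * s < 1 \/ 2 < 3 * s \/ 1 <= y.
      have [|h1] := ltP (3 * s) 1; first by left.
      have [|h2] := ltP 2 (3 * s); first by right; left.
      by right; right; rewrite /y le_min h1 /=; lra.
    have g : [\/ clamp 1 y = 1, phi s = 0 | phi s = 1].
      rewrite /phi; case: y3 => [h|[h|h]].
      - by constructor 2; have [[? ->]|[? ->]|[? ->]] := clamp_spec (3 * s - 1) (@ler01 R); lra.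
      - by constructor 3; have [[? ->]|[? ->]|[? ->]] := clamp_spec (3 * s - 1) (@ler01 R); lra.
      - by constructor 1; have [[? ->]|[? ->]|[? ->]] := clamp_spec y (@ler01 R); lra.
    split.
    - by have [[? ->]|[? ->]|[? ->]] := clamp_spec y (@ler01 R); lra.
    - by have [[? ->]|[? ->]|[? ->]] := clamp_spec y (@ler01 R); lra.
    - case: g => [->|->|->]; [by left| |]; right; rewrite Lid ?lexx ?ler01 //.
  have tauP k t : 0 <= tau k t <= 1.
    by rewrite /tau; have [[? ->]|[? ->]|[? ->]] := clamp_spec (3 * t - k) (@ler01 R); lra.
  split.
  + apply: continuous_subspaceT; apply: continuous_two_rays => //.
    * by apply: continuous_subf => //; apply: continuous_mulf.
    * by apply: continuous_mulf.
    * by move=> ?; exact: cvg_cst.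
  + move=> z [[s t] [/=]]; rewrite !in_itv /= => s01 t01 <-.
    have [m0 m1 mr] := rest s s01.
    have /andP[t10 t11] := tauP 1 t; have /andP[t20 t21] := tauP 2 t.
    have [h|h] := leP t (2 / 3).
      rewrite (_ : tau 2 t = 0) ?mul0r ?two_raysl; last first.
        by rewrite /tau; have [[? ->]|[? ->]|[? ->]] := clamp_spec (3 * t - 2) (@ler01 R); lra.
      by apply: sA; [exact: LA|nra].
    have e1 : tau 1 t = 1.
      by rewrite /tau; have [[? ->]|[? ->]|[? ->]] := clamp_spec (3 * t - 1) (@ler01 R); lra.
    have e0 : tau 0 t = 1.
      by rewrite /tau; have [[? ->]|[? ->]|[? ->]] := clamp_spec (3 * t - 0) (@ler01 R); lra.
    rewrite e1 mul1r /th /= e0 subrr mul0r add0r mul1r.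
    case: mr => [->|->].
      by rewrite subrr two_raysr mulr1; apply: sA => //; lra.
    by rewrite two_rays_same; apply: sA => //; nra.
  + move=> s s01; have [m0 m1 mr] := rest s s01; split.
      have e k : 0 <= k -> tau k 0 = 0.
        by move=> k0; rewrite /tau; have [[? ->]|[? ->]|[? ->]] := clamp_spec (3 * 0 - k) (@ler01 R); lra.
      rewrite /= /th /= !e // !mul0r two_raysl !subr0 homothety1 mul1r addr0.
      exact: Lid.
    have e k : k <= 2 -> tau k 1 = 1.
      by move=> k0; rewrite /tau; have [[? ->]|[? ->]|[? ->]] := clamp_spec (3 * 1 - k) (@ler01 R); lra.
    rewrite /= /th /= !e; [|lra|lra|lra].
    rewrite subrr mul0r add0r !mul1r.
    case: mr => [->|->]; first by rewrite subrr two_raysr homothety1.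
    by rewrite two_rays_same subrK homothety1.
  + move=> t t01.
    have m00 : m 0 = 0.
      rewrite /m mulr0 subr0 min_l; last lra.
      by have [[? ->]|[? ->]|[? ->]] := clamp_spec (0 : R) (@ler01 R); lra.
    have m10 : m 1 = 0.
      rewrite /m mulr1 subrr min_r; last lra.
      by have [[? ->]|[? ->]|[? ->]] := clamp_spec (0 : R) (@ler01 R); lra.
    rewrite /= m00 m10 !mulr0 !subr0 !two_raysl !homothety1 /th /=.
    have p0 : phi 0 = 0.
      by rewrite /phi; have [[? ->]|[? ->]|[? ->]] := clamp_spec (3 * 0 - 1 : R) (@ler01 R); lra.
    have p1 : phi 1 = 1.
      by rewrite /phi; have [[? ->]|[? ->]|[? ->]] := clamp_spec (3 * 1 - 1 : R) (@ler01 R); lra.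
    rewrite p0 p1 !mulr0 addr0 !mulr1 subrK l01.
    by rewrite !Lid ?lexx ?ler01.
Qed.

End Star.

(** * Arc-length parametrization of the extremal pairs *)

Section Clamp.
Context {R : realType}.
Implicit Types u v w x : R.

Lemma clampL w x : 0 <= w -> x <= 0 -> clamp w x = 0.
Proof. by move=> w0 x0; have [[? ->]|[? ->]|[? ->]] := clamp_spec x w0; lra. Qed.

Lemma clampM w x : 0 <= x <= w -> clamp w x = x.
Proof.
move=> xw; have w0 : 0 <= w by lra.
by have [[? ->]|[? ->]|[? ->]] := clamp_spec x w0; lra.
Qed.

Lemma clampH w x : 0 <= w -> w <= x -> clamp w x = w.
Proof. by move=> w0 x0; have [[? ->]|[? ->]|[? ->]] := clamp_spec x w0; lra. Qed.

Lemma clampD a b x : 0 <= a -> 0 <= b -> clamp a x + clamp b (x - a) = clamp (a + b) x.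
Proof.
move=> a0 b0; have ab0 : 0 <= a + b by lra.
have [[? ->]|[? ->]|[? ->]] := clamp_spec x a0;
have [[? ->]|[? ->]|[? ->]] := clamp_spec (x - a) b0;
have [[? ->]|[? ->]|[? ->]] := clamp_spec x ab0; lra.
Qed.

Lemma le_clamp w u v : 0 <= w -> u <= v -> clamp w u <= clamp w v.
Proof.
move=> w0 uv; have [[? ->]|[? ->]|[? ->]] := clamp_spec u w0;
have [[? ->]|[? ->]|[? ->]] := clamp_spec v w0; lra.
Qed.

End Clamp.

Ltac clamps := repeat match goal with |- context [@clamp ?R ?w ?x] =>
  first [ rewrite (@clampL R w x); [|lra|lra]
        | rewrite (@clampH R w x); [|lra|lra]
        | rewrite (@clampM R w x); [|lra] ] end.

Section BoundaryParam.
Context {R : realType}.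

Definition rescale (g : R -> R * R) (P t : R) : R * R := g (P * t).

(** A closed path g of l^1 speed at most one, defined on [0, P]. *)
Lemma boundary_curve_param (A : set (R * R)) (g : R -> R * R) (P : R) : 0 < P ->
  continuous g -> g 0 = g P ->
  (forall u v, 0 <= u < P -> 0 <= v < P -> g u = g v -> u = v) ->
  (forall u v, 0 <= u -> u <= v -> v <= P -> l1dist (g u) (g v) <= v - u) ->
  topboundary A = g @` `[0, P] ->
  boundary_curve A (rescale g P) /\ (rho 0 1 (rescale g P) <= P%:E)%E.
Proof.
move=> P0 cg gP inj lip bA.
have rP : (rho 0 1 (rescale g P) <= P%:E)%E.
  have := @rho_le_lipschitz R 0 1 (rescale g P) P ler01 (ltW P0).
  rewrite subr0 mulr1; apply => s t s0 st t1; rewrite mulrBr.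
  by apply: lip; nra.
split => //; split.
- apply: continuous_subspaceT => t; apply: continuous_comp; last exact: cg.
  by apply: cvgM; [exact: cvg_cst|exact: cvg_id].
- split; first by rewrite /rescale mulr0 mulr1.
  move=> s t s01 t01 /inj gst; apply: (mulfI (lt0r_neq0 P0)); apply: gst; nra.
- by apply: le_lt_trans rP _; rewrite ltry.
- rewrite bA; apply/seteqP; split => p [t /=]; rewrite in_itv /= => /andP[t0 t1] <-.
    exists (t / P) => /=; last by rewrite /rescale mulrC divfK // gt_eqF.
    by rewrite in_itv /= divr_ge0 ?(ltW P0) //= ler_pdivrMr // mul1r.
  by exists (P * t) => //=; rewrite in_itv /=; nra.
Qed.

End BoundaryParam.

Section Shapes.
Context {R : realType}.
Variables (W k w h e : R).

(** W and k are the width and the depth of the lower part of the hexagon, e is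
    the height of its upper part, and w and h are the sides of the box. When the
    box is as wide as the hexagon there is no room for an upper part. *)
Definition admissible : Prop :=
  [/\ 0 < w <= W, 0 < k, 0 < h, 0 <= e <= h & w < W \/ e = 0].

(** The rectangle ]0, W[ x ]-k, e[ minus the quadrant x <= w, y >= 0, which leaves
    room for the box. For e = 0 this is a rectangle with the box on top of it,
    and for e = h the box fills a corner of a rectangle. *)
Definition notched : set (R * R) := [set p | [/\ 0 < p.1 < W, - k < p.2 < e &
  w < p.1 \/ p.2 < 0]].
Definition notched_closed : set (R * R) := [set p | [/\ 0 <= p.1 <= W, - k <= p.2 <= e &
  w <= p.1 \/ p.2 <= 0]].
Definition box : set (R * R) := [set p | 0 < p.1 < w /\ 0 < p.2 < h].
Definition box_closed : set (R * R) := [set p | 0 <= p.1 <= w /\ 0 <= p.2 <= h].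
(** The two sides of the notch: the common boundary of the two sets. *)
Definition contact : set (R * R) :=
  [set p | 0 <= p.1 <= w /\ p.2 = 0 \/ p.1 = w /\ 0 <= p.2 <= e].

(** The boundary of the hexagon from the origin: right along the bottom of the
    notch, up its side, then along the four outer sides. Sides
    of length 0 cause no degeneracy, as they take no time. *)
Definition notched_path (u : R) : R * R :=
  (clamp w u + clamp (W - w) (u - (w + e)) - clamp W (u - (W + 2 * e + k)),
   clamp e (u - w) + clamp k (u - (2 * W + 2 * e + k)) - clamp (e + k) (u - (W + e))).
Definition notched_length : R := 2 * W + 2 * e + 2 * k.
(** Both paths start at the origin and agree up to time w + e. *)
Definition box_path (u : R) : R * R :=
  (clamp w u - clamp w (u - (w + h)), clamp h (u - w) - clamp h (u - (2 * w + h))).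
Definition box_length : R := 2 * w + 2 * h.

Hypothesis adm : admissible.

Lemma notched_path_side1 u : 0 <= u -> u <= w -> notched_path u = (u, 0).
Proof.
move: adm => [/andP[w0 wW] k0 h0 /andP[e0 eh] _] u0 u1.
rewrite /notched_path; clamps; congr (_, _); lra.
Qed.

Lemma notched_path_side2 u : w <= u -> u <= w + e -> notched_path u = (w, u - w).
Proof.
move: adm => [/andP[w0 wW] k0 h0 /andP[e0 eh] _] u0 u1.
rewrite /notched_path; clamps; congr (_, _); lra.
Qed.

Lemma notched_path_side3 u : w + e <= u -> u <= W + e -> notched_path u = (u - e, e).
Proof.
move: adm => [/andP[w0 wW] k0 h0 /andP[e0 eh] _] u0 u1.
rewrite /notched_path; clamps; congr (_, _); lra.
Qed.

Lemma notched_path_side4 u : W + e <= u -> u <= W + 2 * e + k ->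
  notched_path u = (W, W + 2 * e - u).
Proof.
move: adm => [/andP[w0 wW] k0 h0 /andP[e0 eh] _] u0 u1.
rewrite /notched_path; clamps; congr (_, _); lra.
Qed.

Lemma notched_path_side5 u : W + 2 * e + k <= u -> u <= 2 * W + 2 * e + k ->
  notched_path u = (2 * W + 2 * e + k - u, - k).
Proof.
move: adm => [/andP[w0 wW] k0 h0 /andP[e0 eh] _] u0 u1.
rewrite /notched_path; clamps; congr (_, _); lra.
Qed.

Lemma notched_path_side6 u : 2 * W + 2 * e + k <= u -> u <= notched_length ->
  notched_path u = (0, u - notched_length).
Proof.
move: adm => [/andP[w0 wW] k0 h0 /andP[e0 eh] _] u0 u1.
rewrite /notched_length in u1 *; rewrite /notched_path; clamps; congr (_, _); lra.
Qed.

Lemma box_path_side1 u : 0 <= u -> u <= w -> box_path u = (u, 0).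
Proof.
move: adm => [/andP[w0 wW] k0 h0 /andP[e0 eh] _] u0 u1.
rewrite /box_path; clamps; congr (_, _); lra.
Qed.

Lemma box_path_side2 u : w <= u -> u <= w + h -> box_path u = (w, u - w).
Proof.
move: adm => [/andP[w0 wW] k0 h0 /andP[e0 eh] _] u0 u1.
rewrite /box_path; clamps; congr (_, _); lra.
Qed.

Lemma box_path_side3 u : w + h <= u -> u <= 2 * w + h ->
  box_path u = (2 * w + h - u, h).
Proof.
move: adm => [/andP[w0 wW] k0 h0 /andP[e0 eh] _] u0 u1.
rewrite /box_path; clamps; congr (_, _); lra.
Qed.

Lemma box_path_side4 u : 2 * w + h <= u -> u <= box_length ->
  box_path u = (0, box_length - u).
Proof.
move: adm => [/andP[w0 wW] k0 h0 /andP[e0 eh] _] u0 u1.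
rewrite /box_length in u1 *; rewrite /box_path; clamps; congr (_, _); lra.
Qed.

Lemma notched_pieces u : 0 <= u -> u <= notched_length ->
  [\/ [/\ 0 <= u, u <= w & notched_path u = (u, 0)],
      [/\ w <= u, u <= w + e & notched_path u = (w, u - w)] |
      [/\ w + e <= u, u <= W + e & notched_path u = (u - e, e)]] \/
  [\/ [/\ W + e <= u, u <= W + 2 * e + k & notched_path u = (W, W + 2 * e - u)],
      [/\ W + 2 * e + k <= u, u <= 2 * W + 2 * e + k &
          notched_path u = (2 * W + 2 * e + k - u, - k)] |
      [/\ 2 * W + 2 * e + k <= u, u <= notched_length &
          notched_path u = (0, u - notched_length)]].
Proof.
move=> u0 uP.
have [u1|/ltW u1] := lerP u w.
  by left; constructor 1; rewrite notched_path_side1.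
have [u2|/ltW u2] := lerP u (w + e).
  by left; constructor 2; rewrite notched_path_side2.
have [u3|/ltW u3] := lerP u (W + e).
  by left; constructor 3; rewrite notched_path_side3.
have [u4|/ltW u4] := lerP u (W + 2 * e + k).
  by right; constructor 1; rewrite notched_path_side4.
have [u5|/ltW u5] := lerP u (2 * W + 2 * e + k).
  by right; constructor 2; rewrite notched_path_side5.
by right; constructor 3; rewrite notched_path_side6.
Qed.

Lemma box_pieces u : 0 <= u -> u <= box_length ->
  [\/ [/\ 0 <= u, u <= w & box_path u = (u, 0)],
      [/\ w <= u, u <= w + h & box_path u = (w, u - w)],
      [/\ w + h <= u, u <= 2 * w + h & box_path u = (2 * w + h - u, h)] |
      [/\ 2 * w + h <= u, u <= box_length & box_path u = (0, box_length - u)]].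
Proof.
move=> u0 uP.
have [u1|/ltW u1] := lerP u w.
  by constructor 1; rewrite box_path_side1.
have [u2|/ltW u2] := lerP u (w + h).
  by constructor 2; rewrite box_path_side2.
have [u3|/ltW u3] := lerP u (2 * w + h).
  by constructor 3; rewrite box_path_side3.
by constructor 4; rewrite box_path_side4.
Qed.

Lemma notched_path_inj u v : 0 <= u < notched_length -> 0 <= v < notched_length ->
  notched_path u = notched_path v -> u = v.
Proof.
move=> /andP[u0 uP] /andP[v0 vP].
have hu := notched_pieces u0 (ltW uP); have hv := notched_pieces v0 (ltW vP).
move: adm hu hv uP vP.
move=> [/andP[w0 wW] k0 h0 /andP[e0 eh] we]; rewrite /notched_length.
move=> hu hv uP vP; case: we => hyp; case: hu => -[] [u1 u2 ->]; case: hv => -[] [v1 v2 ->] eq;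
  have /= e1 := congr1 fst eq; have /= e2 := congr1 snd eq; lra.
Qed.

Lemma box_path_inj u v : 0 <= u < box_length -> 0 <= v < box_length ->
  box_path u = box_path v -> u = v.
Proof.
move=> /andP[u0 uP] /andP[v0 vP].
have hu := box_pieces u0 (ltW uP); have hv := box_pieces v0 (ltW vP).
move: adm hu hv uP vP.
move=> [/andP[w0 wW] k0 h0 /andP[e0 eh] we]; rewrite /box_length.
move=> hu hv uP vP; case: hu => -[u1 u2 ->]; case: hv => -[v1 v2 ->] eq;
  have /= e1 := congr1 fst eq; have /= e2 := congr1 snd eq; lra.
Qed.

Lemma sub_norm_le (a b c a' b' c' : R) : a <= a' -> b <= b' -> c <= c' ->
  `|a' + b' - c' - (a + b - c)| <= (a' - a) + (b' - b) + (c' - c).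
Proof. by move=> *; rewrite ler_norml; apply/andP; split; lra. Qed.

(** The six ramps add up to the identity, so the total variation of the two
    coordinates between two times is at most the elapsed time. *)
Lemma notched_path_lip u v : 0 <= u -> u <= v -> v <= notched_length ->
  l1dist (notched_path u) (notched_path v) <= v - u.
Proof.
move=> u0 uv vP; move: adm => [/andP[w0 wW] k0 h0 /andP[e0 eh] we].
have W0 : 0 <= W by lra.
have Ww : 0 <= W - w by lra.
have ek : 0 <= e + k by lra.
have sumE x : 0 <= x -> x <= notched_length ->
    clamp w x + clamp e (x - w) + clamp (W - w) (x - (w + e)) +
    clamp (e + k) (x - (W + e)) + clamp W (x - (W + 2 * e + k)) +
    clamp k (x - (2 * W + 2 * e + k)) = x.
  rewrite /notched_length => x0 xP.
  rewrite clampD ?(ltW w0) // clampD //; last by lra.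
  rewrite (_ : W + e = w + e + (W - w)) ?clampD; [|lra|lra|lra].
  rewrite (_ : W + 2 * e + k = w + e + (W - w) + (e + k)) ?clampD; [|lra|lra|lra].
  rewrite (_ : 2 * W + 2 * e + k = w + e + (W - w) + (e + k) + W) ?clampD; [|lra|lra|lra].
  by apply: clampM; lra.
have su := sumE u u0 (le_trans uv vP).
have sv := sumE v (le_trans u0 uv) vP.
rewrite /l1dist /notched_path /=.
have m1 := le_clamp (ltW w0) uv.
have m2 := le_clamp e0 (lerB uv (lexx w)).
have m3 := le_clamp Ww (lerB uv (lexx (w + e))).
have m4 := le_clamp ek (lerB uv (lexx (W + e))).
have m5 := le_clamp W0 (lerB uv (lexx (W + 2 * e + k))).
have m6 := le_clamp (ltW k0) (lerB uv (lexx (2 * W + 2 * e + k))).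
have g1 := sub_norm_le m1 m3 m5; have g2 := sub_norm_le m2 m6 m4.
lra.
Qed.

Lemma box_path_lip u v : 0 <= u -> u <= v -> v <= box_length ->
  l1dist (box_path u) (box_path v) <= v - u.
Proof.
move=> u0 uv vP; move: adm => [/andP[w0 wW] k0 h0 /andP[e0 eh] we].
have sumE x : 0 <= x -> x <= box_length ->
    clamp w x + clamp h (x - w) + clamp w (x - (w + h)) + clamp h (x - (2 * w + h)) = x.
  rewrite /box_length => x0 xP.
  rewrite clampD ?(ltW w0) ?(ltW h0) // clampD //; [|lra|lra].
  rewrite (_ : 2 * w + h = w + h + w) ?clampD; [|lra|lra|lra].
  by apply: clampM; lra.
have su := sumE u u0 (le_trans uv vP).
have sv := sumE v (le_trans u0 uv) vP.
rewrite /l1dist /box_path /=.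
have m1 := le_clamp (ltW w0) uv.
have m2 := le_clamp (ltW h0) (lerB uv (lexx w)).
have m3 := le_clamp (ltW w0) (lerB uv (lexx (w + h))).
have m4 := le_clamp (ltW h0) (lerB uv (lexx (2 * w + h))).
have g1 := sub_norm_le m1 (lexx 0) m3; have g2 := sub_norm_le m2 (lexx 0) m4.
rewrite !addr0 in g1 g2; lra.
Qed.

Lemma notched_path_continuous : continuous notched_path.
Proof.
have cc (x : R) : continuous (fun u : R => clamp x u).
  by apply: continuous_clamp => t; exact: cvg_id.
have cs (x y : R) : continuous (fun u : R => clamp x (u - y)).
  apply: continuous_clamp; apply: continuous_subf => t; [exact: cvg_id|exact: cvg_cst].
by apply: continuous_pairf; apply: continuous_subf => //; exact: continuous_addf.
Qed.

Lemma box_path_continuous : continuous box_path.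
Proof.
have cc (x : R) : continuous (fun u : R => clamp x u).
  by apply: continuous_clamp => t; exact: cvg_id.
have cs (x y : R) : continuous (fun u : R => clamp x (u - y)).
  apply: continuous_clamp; apply: continuous_subf => t; [exact: cvg_id|exact: cvg_cst].
by apply: continuous_pairf; exact: continuous_subf.
Qed.

Lemma notched_path_closed : notched_path 0 = notched_path notched_length.
Proof.
move: adm => [/andP[w0 wW] k0 h0 /andP[e0 eh] _].
by rewrite notched_path_side1 ?notched_path_side6 ?subrr // /notched_length; lra.
Qed.

Lemma box_path_closed : box_path 0 = box_path box_length.
Proof.
move: adm => [/andP[w0 wW] k0 h0 /andP[e0 eh] _].
by rewrite box_path_side1 ?box_path_side4 ?subrr // /box_length; lra.
Qed.

End Shapes.

(** * Topology of the extremal pairs *)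

Section StarBoundary.
Context {R : realType}.
Implicit Types (A C : set (R * R)) (c p : R * R).

Lemma homothety_continuous c p : continuous (fun r : R => homothety c r p).
Proof.
have cc (k : R) : continuous (fun _ : R => k) by move=> ?; exact: cvg_cst.
have ci : continuous (fun r : R => r) by move=> ?; exact: cvg_id.
by apply: continuous_pairf; apply: continuous_addf => //; exact: continuous_mulf.
Qed.

(** Contracting a point of the closed set towards c enters A, so that the closed
    set is the closure of A. *)
Lemma topboundary_star A C c : open A -> closed C -> A `<=` C ->
  (forall p r, C p -> 0 <= r < 1 -> A (homothety c r p)) ->
  topboundary A = C `\` A.
Proof.
move=> oA cC AC hC; rewrite /topboundary (interior_id _).1 //; congr (_ `\` _).
apply/seteqP; split => p.
  by move=> clp; apply: cC; exact: (closure_subset AC).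
move=> Cp U Up.
have : nbhs (1 : R) [set r | U (homothety c r p)].
  by apply: homothety_continuous; rewrite homothety1.
move=> /nbhs_ballP[d /= d0 hd].
pose r := Num.max 0 (1 - d / 2).
have r1 : r < 1 by rewrite /r gt_max ltr01 /=; lra.
have r2 : 1 - d / 2 <= r by rewrite /r le_max lexx orbT.
exists (homothety c r p); split.
  by apply: hC => //; rewrite r1 andbT /r le_max lexx.
by apply: hd; rewrite /ball /= ltr_norml; apply/andP; split; lra.
Qed.

Lemma star_shaped_strict A C c : A `<=` C ->
  (forall p r, C p -> 0 <= r < 1 -> A (homothety c r p)) -> star_shaped A c.
Proof.
move=> AC hC p r Ap /andP[r0 r1].
have [->|rn1] := eqVneq r 1; first by rewrite homothety1.
by apply: hC; [exact: AC|rewrite r0 lt_neqAle rn1].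
Qed.

Lemma conv_gt (a c p r : R) : a < c -> a <= p -> 0 <= r < 1 -> a < c + r * (p - c).
Proof.
move=> ac ap /andP[r0 r1]; rewrite -subr_gt0.
have -> : c + r * (p - c) - a = (1 - r) * (c - a) + r * (p - a) by ring.
by rewrite ltr_pwDl ?mulr_gt0 ?mulr_ge0 ?subr_gt0 ?subr_ge0.
Qed.

Lemma conv_lt (a c p r : R) : c < a -> p <= a -> 0 <= r < 1 -> c + r * (p - c) < a.
Proof.
move=> ca pa r01; have := @conv_gt (- a) (- c) (- p) r.
rewrite !ltrN2 lerN2 => /(_ ca pa r01); lra.
Qed.

Lemma open_coord (a : R) : [/\ open [set p : R * R | a < p.1],
  open [set p : R * R | p.1 < a], open [set p : R * R | a < p.2] &
  open [set p : R * R | p.2 < a]].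
Proof.
split.
- by apply: (@open_comp _ _ fst [set y | a < y]); [move=> ? _; exact: cvg_fst|exact: open_gt].
- by apply: (@open_comp _ _ fst [set y | y < a]); [move=> ? _; exact: cvg_fst|exact: open_lt].
- by apply: (@open_comp _ _ snd [set y | a < y]); [move=> ? _; exact: cvg_snd|exact: open_gt].
- by apply: (@open_comp _ _ snd [set y | y < a]); [move=> ? _; exact: cvg_snd|exact: open_lt].
Qed.

Lemma closed_coord (a : R) : [/\ closed [set p : R * R | a <= p.1],
  closed [set p : R * R | p.1 <= a], closed [set p : R * R | a <= p.2] &
  closed [set p : R * R | p.2 <= a]].
Proof.
split.
- by apply: (@preimage_closed _ _ fst [set y | a <= y]); [move=> ? _; exact: cvg_fst|exact: closed_ge].
- by apply: (@preimage_closed _ _ fst [set y | y <= a]); [move=> ? _; exact: cvg_fst|exact: closed_le].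
- by apply: (@preimage_closed _ _ snd [set y | a <= y]); [move=> ? _; exact: cvg_snd|exact: closed_ge].
- by apply: (@preimage_closed _ _ snd [set y | y <= a]); [move=> ? _; exact: cvg_snd|exact: closed_le].
Qed.

End StarBoundary.

Section ShapesTopology.
Context {R : realType}.
Variables (W k w h e : R).
Hypothesis adm : admissible W k w h e.
Local Notation A := (notched W k w e).
Local Notation Ac := (notched_closed W k w e).
Local Notation B := (box w h).
Local Notation Bc := (box_closed w h).
Local Notation f := (notched_path W k w e).
Local Notation g := (box_path w h).
Local Notation P := (notched_length W k e).
Local Notation Q := (box_length w h).

Lemma open_notched : open A.
Proof.
rewrite (_ : A = [set p | 0 < p.1] `&` [set p | p.1 < W] `&` [set p | - k < p.2] `&`
  [set p | p.2 < e] `&` ([set p | w < p.1] `|` [set p | p.2 < 0])).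
  have [? _ _ _] := open_coord (0 : R); have [_ ? _ _] := open_coord W.
  have [_ _ ? _] := open_coord (- k); have [_ _ _ ?] := open_coord e.
  have [? _ _ _] := open_coord w; have [_ _ _ ?] := open_coord (0 : R).
  by repeat apply: openI => //; exact: openU.
apply/seteqP; split => p.
  by move=> [/andP[? ?] /andP[? ?] ?]; split.
by move=> [[[[/= ? ?] ?] ?] ?]; split => //; apply/andP.
Qed.

Lemma closed_notched : closed Ac.
Proof.
rewrite (_ : Ac = [set p | 0 <= p.1] `&` [set p | p.1 <= W] `&` [set p | - k <= p.2] `&`
  [set p | p.2 <= e] `&` ([set p | w <= p.1] `|` [set p | p.2 <= 0])).
  have [? _ _ _] := closed_coord (0 : R); have [_ ? _ _] := closed_coord W.
  have [_ _ ? _] := closed_coord (- k); have [_ _ _ ?] := closed_coord e.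
  have [? _ _ _] := closed_coord w; have [_ _ _ ?] := closed_coord (0 : R).
  by repeat apply: closedI => //; exact: closedU.
apply/seteqP; split => p.
  by move=> [/andP[? ?] /andP[? ?] ?]; split.
by move=> [[[[/= ? ?] ?] ?] ?]; split => //; apply/andP.
Qed.

Lemma open_box : open B.
Proof.
rewrite (_ : B = [set p | 0 < p.1] `&` [set p | p.1 < w] `&` [set p | 0 < p.2] `&`
  [set p | p.2 < h]).
  have [? _ ? _] := open_coord (0 : R); have [_ ? _ _] := open_coord w.
  have [_ _ _ ?] := open_coord h.
  by repeat apply: openI => //.
apply/seteqP; split => p.
  by move=> [/andP[? ?] /andP[? ?]]; split.
by move=> [[[/= ? ?] ?] ?]; split => //; apply/andP.
Qed.

Lemma closed_box : closed Bc.
Proof.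
rewrite (_ : Bc = [set p | 0 <= p.1] `&` [set p | p.1 <= w] `&` [set p | 0 <= p.2] `&`
  [set p | p.2 <= h]).
  have [? _ ? _] := closed_coord (0 : R); have [_ ? _ _] := closed_coord w.
  have [_ _ _ ?] := closed_coord h.
  by repeat apply: closedI => //.
apply/seteqP; split => p.
  by move=> [/andP[? ?] /andP[? ?]]; split.
by move=> [[[/= ? ?] ?] ?]; split => //; apply/andP.
Qed.

Lemma notched_sub : A `<=` Ac.
Proof.
move=> p [/andP[? ?] /andP[? ?] c]; split; [lra|lra|].
by case: c => /ltW; [left|right].
Qed.

Lemma box_sub : B `<=` Bc.
Proof. by move=> p [/andP[? ?] /andP[? ?]]; split; lra. Qed.

(** A centre from which every point of both arms is visible; it lies in the
    part of the lower arm that is not below the box, unless e = 0. *)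
Lemma notched_center : exists c : R * R, forall p r, Ac p -> 0 <= r < 1 -> A (homothety c r p).
Proof.
move: adm => [/andP[w0 wW] k0 h0 /andP[e0 eh] we].
have [c [c0 cW cwe]] : exists c : R, [/\ 0 < c, c < W & w < c \/ e = 0].
  case: we => [ww|e1]; last by exists (W / 2); split; [lra|lra|right].
  by exists ((w + W) / 2); split; [lra|lra|left; lra].
exists (c, - k / 2) => -[x y] r [/= /andP[x0 xW] /andP[yk ye] xy] r01.
split => /=.
- by rewrite conv_gt // conv_lt.
- by rewrite conv_gt ?conv_lt //; lra.
- case: xy => [wx|y0]; last by right; apply: conv_lt => //; lra.
  case: cwe => [wc|e1]; first by left; exact: conv_gt.
  by right; apply: conv_lt => //; lra.
Qed.

Lemma box_center : exists c : R * R, forall p r, Bc p -> 0 <= r < 1 -> B (homothety c r p).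
Proof.
move: adm => [/andP[w0 wW] k0 h0 _ _].
exists (w / 2, h / 2) => -[x y] r [/= /andP[x0 xW] /andP[yk ye]] r01.
by split => /=; rewrite conv_gt ?conv_lt //; lra.
Qed.

Lemma image_itvP (l : R -> R * R) (a b : R) p :
  (l @` `[a, b]) p <-> exists u, [/\ a <= u, u <= b & l u = p].
Proof.
split=> [[u /=]|[u [au ub <-]]].
  by rewrite in_itv /= => /andP[? ?] <-; exists u.
by exists u => //=; rewrite in_itv /= au ub.
Qed.

Lemma topboundary_notched : topboundary A = f @` `[0, P].
Proof.
have [c hc] := notched_center.
rewrite (topboundary_star open_notched closed_notched notched_sub hc).
apply/seteqP; split => [[x y]|p].
- move=> [[/= /andP[x0 xW] /andP[yk ye] xy] nA]; apply/image_itvP.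
  move: adm => [/andP[w0 wW] k0 h0 /andP[e0 eh] we].
  rewrite /notched_length.
  have [yk'|yk'] := leP y (- k).
    exists (2 * W + 2 * e + k - x); split; [lra|lra|rewrite (notched_path_side5 adm); [congr (_, _)|..]; lra].
  have [x0'|x0'] := leP x 0.
    case: xy => [?|y0]; first lra.
    exists (2 * W + 2 * e + 2 * k + y); split; [lra|lra|rewrite (notched_path_side6 adm); [congr (_, _)|..]; rewrite /notched_length; lra].
  have [xW'|xW'] := leP W x.
    exists (W + 2 * e - y); split; [lra|lra|rewrite (notched_path_side4 adm); [congr (_, _)|..]; lra].
  have [xw|wx] := leP x w.
    have [y0|y0] := leP 0 y; last first.
      by exfalso; apply: nA; split => /=; [lra|lra|right].
    case: xy => [xw'|y0'].
      by exists (w + y); split; [lra|lra|rewrite (notched_path_side2 adm); [congr (_, _)|..]; lra].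
    by exists x; split; [lra|lra|rewrite (notched_path_side1 adm); [congr (_, _)|..]; lra].
  have [ey|ye'] := leP e y.
    by exists (x + e); split; [lra|lra|rewrite (notched_path_side3 adm); [congr (_, _)|..]; lra].
  by exfalso; apply: nA; split => /=; [lra|lra|left].
- move=> /image_itvP[u [u0 uP <-]]; have hu := notched_pieces adm u0 uP; move: hu uP adm; rewrite /notched_length.
  move=> hu uP [/andP[w0 wW] k0 h0 /andP[e0 eh] we].
  case: hu => -[] [u1 u2 ->]; split; rewrite /notched_closed /notched /=;
    try (by split; [lra|lra|first [left; lra|right; lra]]);
    move=> [/andP[? ?] /andP[? ?] []]; lra.
Qed.

Lemma topboundary_box : topboundary B = g @` `[0, Q].
Proof.
have [c hc] := box_center.
rewrite (topboundary_star open_box closed_box box_sub hc).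
apply/seteqP; split => [[x y]|p].
- move=> [[/= /andP[x0 xW] /andP[yk ye]] nA]; apply/image_itvP.
  move: adm => [/andP[w0 wW] k0 h0 /andP[e0 eh] we].
  rewrite /box_length.
  have [yk'|yk'] := leP y 0.
    by exists x; split; [lra|lra|rewrite (box_path_side1 adm); [congr (_, _)|..]; lra].
  have [xW'|xW'] := leP w x.
    by exists (w + y); split; [lra|lra|rewrite (box_path_side2 adm); [congr (_, _)|..]; lra].
  have [hy|yh] := leP h y.
    by exists (2 * w + h - x); split; [lra|lra|rewrite (box_path_side3 adm); [congr (_, _)|..]; lra].
  have [x0'|x0'] := leP x 0.
    by exists (2 * w + 2 * h - y); split; [lra|lra|rewrite (box_path_side4 adm); [congr (_, _)|..]; rewrite /box_length; lra].
  by exfalso; apply: nA; split => /=; lra.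
- move=> /image_itvP[u [u0 uP <-]]; have hu := box_pieces adm u0 uP; move: hu uP adm; rewrite /box_length.
  move=> hu uP [/andP[w0 wW] k0 h0 /andP[e0 eh] we].
  case: hu => -[u1 u2 ->]; split; rewrite /box_closed /box /=;
    try (by split; lra);
    move=> [/andP[? ?] /andP[? ?]]; lra.
Qed.

Lemma contactE : topboundary A `&` topboundary B = contact w e.
Proof.
have [c hc] := notched_center; have [c' hc'] := box_center.
rewrite (topboundary_star open_notched closed_notched notched_sub hc).
rewrite (topboundary_star open_box closed_box box_sub hc').
move: adm => [/andP[w0 wW] k0 h0 /andP[e0 eh] we].
apply/seteqP; split => [[x y]|[x y]].
- move=> [[[/= /andP[a1 a2] /andP[a3 a4] a5] _] [[/= /andP[b1 b2] /andP[b3 b4]] _]].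
  rewrite /contact /=; case: a5 => ?; [right|left]; split; lra.
- rewrite /contact /= => -[[/andP[x0 xw] y0]|[xw /andP[y0 ye]]].
  + split; split; rewrite /notched_closed /notched /box /box_closed /=.
    * by split; [lra|lra|right; lra].
    * by move=> [/andP[? ?] /andP[? ?] []]; lra.
    * by split; lra.
    * by move=> [/andP[? ?] /andP[? ?]]; lra.
  + split; split; rewrite /notched_closed /notched /box /box_closed /=.
    * by split; [lra|lra|left; lra].
    * by move=> [/andP[? ?] /andP[? ?] []]; lra.
    * by split; lra.
    * by move=> [/andP[? ?] /andP[? ?]]; lra.
Qed.

Lemma notched_contact : f @` `[0, w + e] = contact w e.
Proof.
move: adm => [/andP[w0 wW] k0 h0 /andP[e0 eh] we].
apply/seteqP; split => [p /image_itvP[u [u0 uwe <-]]|[x y]].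
- have [uw|/ltW wu] := leP u w.
    by rewrite (notched_path_side1 adm) //; left; split => /=; lra.
  by rewrite (notched_path_side2 adm); [right; split => /=|..]; lra.
- move=> h'; apply/image_itvP; move: h'; rewrite /contact /=.
  move=> [[/andP[x0 xw] y0]|[xw /andP[y0 ye]]].
    by exists x; split; [lra|lra|rewrite (notched_path_side1 adm); [congr (_, _)|..]; lra].
  by exists (w + y); split; [lra|lra|rewrite (notched_path_side2 adm); [congr (_, _)|..]; lra].
Qed.

Lemma box_contact : g @` `[0, w + e] = contact w e.
Proof.
move: adm => [/andP[w0 wW] k0 h0 /andP[e0 eh] we].
apply/seteqP; split => [p /image_itvP[u [u0 uwe <-]]|[x y]].
- have [uw|/ltW wu] := leP u w.
    by rewrite (box_path_side1 adm) //; left; split => /=; lra.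
  by rewrite (box_path_side2 adm); [right; split => /=|..]; lra.
- move=> h'; apply/image_itvP; move: h'; rewrite /contact /=.
  move=> [[/andP[x0 xw] y0]|[xw /andP[y0 ye]]].
    by exists x; split; [lra|lra|rewrite (box_path_side1 adm); [congr (_, _)|..]; lra].
  by exists (w + y); split; [lra|lra|rewrite (box_path_side2 adm); [congr (_, _)|..]; lra].
Qed.

End ShapesTopology.

(** * Perimeter of the extremal pairs *)

Section ShapesPerimeter.
Context {R : realType}.
Variables (W k w h e : R).
Hypothesis adm : admissible W k w h e.
Local Notation A := (notched W k w e).
Local Notation B := (box w h).
Local Notation f := (notched_path W k w e).
Local Notation g := (box_path w h).
Local Notation P := (notched_length W k e).
Local Notation Q := (box_length w h).

Lemma lebesgue_measure_bnd (b1 b2 : bool) (x y : R) : x <= y ->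
  lebesgue_measure ([set` Interval (BSide b1 x) (BSide b2 y)] : set R) = (y - x)%:E.
Proof.
move=> xy; rewrite lebesgue_measure_itv /= lte_fin lt_neqAle xy andbT.
by have [->|] := eqVneq x y; rewrite ?subrr.
Qed.

Lemma mu2_itv_rect (b1 b2 b3 b4 : bool) (x y x' y' : R) : x <= y -> x' <= y' ->
  mu2 ([set` Interval (BSide b1 x) (BSide b2 y)] `*`
       [set` Interval (BSide b3 x') (BSide b4 y')]) = ((y - x) * (y' - x'))%:E.
Proof. by move=> xy xy'; rewrite mu2_rect // !lebesgue_measure_bnd // EFinM. Qed.

Lemma mu2_box : mu2 B = (w * h)%:E.
Proof.
move: adm => [/andP[w0 wW] k0 h0 /andP[e0 eh] we].
rewrite (_ : B = `]0, w[%classic `*` `]0, h[%classic).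
  by rewrite mu2_itv_rect ?(ltW w0) ?(ltW h0) // !subr0.
by apply/seteqP; split => p []; rewrite /= ?in_itv /=; [split|split]; rewrite //= in_itv.
Qed.

Lemma mu2_notched : mu2 A = (W * k + (W - w) * e)%:E.
Proof.
move: adm => [/andP[w0 wW] k0 h0 /andP[e0 eh] we].
have -> : A = (`]0, W[%classic `*` `]-k, 0[%classic) `|` (`]w, W[%classic `*` `[0, e[%classic).
  apply/seteqP; split => [[x y]|[x y]].
    move=> [/= /andP[x0 xW] /andP[yk ye] xy].
    have [y0|y0] := leP 0 y; [right|left]; split; rewrite /= in_itv /=; try lra.
  move=> [] [/=]; rewrite !in_itv /= => /andP[x0 xW] /andP[yk ye]; split => /=; try lra.
rewrite mu2U; [|exact: measurableX|exact: measurableX|].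
  by rewrite !mu2_itv_rect ?subr0 ?opprK ?add0r -?EFinD //; lra.
apply/seteqP; split => // -[x y] [[/= _ +] [/= _]]; rewrite !in_itv /= => ? ?; lra.
Qed.

Lemma length_gt0 : 0 < P /\ 0 < Q.
Proof.
by move: adm => [/andP[w0 wW] k0 h0 /andP[e0 eh] we]; rewrite /notched_length /box_length; split; lra.
Qed.

Lemma boundary_notched : boundary_curve A (rescale f P) /\ (rho 0 1 (rescale f P) <= P%:E)%E.
Proof.
apply: boundary_curve_param.
- exact: length_gt0.1.
- exact: notched_path_continuous.
- exact: (notched_path_closed adm).
- exact: (notched_path_inj adm).
- exact: (notched_path_lip adm).
- exact: (topboundary_notched adm).
Qed.

Lemma boundary_box : boundary_curve B (rescale g Q) /\ (rho 0 1 (rescale g Q) <= Q%:E)%E.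
Proof.
apply: boundary_curve_param.
- exact: length_gt0.2.
- exact: box_path_continuous.
- exact: (box_path_closed adm).
- exact: (box_path_inj adm).
- exact: (box_path_lip adm).
- exact: (topboundary_box adm).
Qed.

Lemma image_rescale (c : R -> R * R) (L t : R) : 0 < L ->
  rescale c L @` `[0, t] = c @` `[0, L * t].
Proof.
move=> L0; apply/seteqP; split => p [u /=]; rewrite in_itv /= => /andP[u0 ut] <-.
  by exists (L * u) => //=; rewrite in_itv /= mulr_ge0 ?(ltW L0) // ler_pM2l.
exists (u / L); last by rewrite /rescale mulrC divfK ?gt_eqF.
by rewrite /= in_itv /= divr_ge0 ?(ltW L0) // ler_pdivrMr // mulrC.
Qed.

Lemma contact_curves : union_disjoint_curves (topboundary A `&` topboundary B).
Proof.
have [we0 weP] : 0 < w + e /\ w + e <= P.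
  by move: adm => [/andP[w0 wW] k0 h0 /andP[e0 eh] we]; rewrite /notched_length; split; lra.
rewrite (contactE adm) -(notched_contact adm).
have im : rescale f (w + e) @` `[0, 1] = f @` `[0, w + e].
  by rewrite image_rescale // mulr1.
exists [set 0%N], (fun=> rescale f (w + e)); split.
- move=> _ _; split.
    apply: continuous_subspaceT => t; apply: continuous_comp; last exact: notched_path_continuous.
    by apply: cvgM; [exact: cvg_cst|exact: cvg_id].
  apply: (@le_lt_trans _ _ (w + e)%:E); last exact: ltry.
  have := @rho_le_lipschitz R 0 1 (rescale f (w + e)) (w + e) ler01 (ltW we0).
  rewrite subr0 mulr1; apply => s t s0 st t1; rewrite mulrBr.
  by apply: (notched_path_lip adm); nra.
- by move=> i j -> ->.
- by rewrite bigcup_set1 im.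
Qed.

Lemma gamma_shapes (al : R) : W * k + (W - w) * e = 1 -> w * h = al -> gamma al A B.
Proof.
move=> a1 a2; split.
- apply/seteqP; split => // -[x y] [[/= ? ? c] [/= /andP[? ?] /andP[? ?]]].
  by case: c => ?; lra.
- split; first exact: open_notched.
    have [c hc] := notched_center adm.
    by apply: (@star_shaped_simply_connected _ _ c); apply: (star_shaped_strict _ hc); exact: notched_sub.
  by exists (rescale f P); exact: boundary_notched.1.
- split; first exact: open_box.
    have [c hc] := box_center adm.
    by apply: (@star_shaped_simply_connected _ _ c); apply: (star_shaped_strict _ hc); exact: box_sub.
  by exists (rescale g Q); exact: boundary_box.1.
- exact: contact_curves.
- by rewrite mu2_notched mu2_box a1 a2.
Qed.

(** A common arc lies on both boundaries, hence in the contact set; conversely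
    the contact set is one common arc, traversed first by both curves. *)
Lemma contact_cap : is_rho_cap (rescale f P) (rescale g Q)
  (rho 0 ((w + e) / P) (rescale f P)).
Proof.
have [P0 Q0] := length_gt0.
have [we0 weP weQ] : [/\ 0 < w + e, w + e <= P & w + e <= Q].
  by move: adm => [/andP[w0 wW] k0 h0 /andP[e0 eh] we];
    rewrite /notched_length /box_length; split; lra.
have imA : rescale f P @` `[0, (w + e) / P] = contact w e.
  by rewrite image_rescale // mulrC divfK ?gt_eqF // (notched_contact adm).
have imB : rescale g Q @` `[0, (w + e) / Q] = contact w e.
  by rewrite image_rescale // mulrC divfK ?gt_eqF // (box_contact adm).
have capE : nontrivial_intersection (rescale f P) (rescale g Q) = contact w e.
  apply/seteqP; split.
    move=> p [[s s'] /= [s0 ss s1 [t [t' [t0 tt t1 eqi]]]]] ip.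
    rewrite -(contactE adm) (topboundary_notched adm) (topboundary_box adm).
    have -> : f @` `[0, P] = rescale f P @` `[0, 1] by rewrite image_rescale // mulr1.
    have -> : g @` `[0, Q] = rescale g Q @` `[0, 1] by rewrite image_rescale // mulr1.
    split.
      by apply: image_subset ip; apply: subset_itv; rewrite bnd_simp.
    have : (rescale g Q @` `[t, t']) p by rewrite -eqi.
    by apply: image_subset; apply: subset_itv; rewrite bnd_simp.
  move=> p cp; exists (0, (w + e) / P) => /=; last by move: cp; rewrite -imA.
  split => //; first by rewrite divr_gt0.
    by rewrite ler_pdivrMr // mul1r.
  exists 0, ((w + e) / Q); split => //; first by rewrite divr_gt0.
    by rewrite ler_pdivrMr // mul1r.
  by rewrite imA imB.
exists [set 0%N], (fun=> 0), (fun=> (w + e) / P); split; last first.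
  by rewrite esum_set1 // rho_ge0 // divr_ge0 // ltW.
split.
- move=> _ _; split => //; first by rewrite divr_gt0.
  by rewrite ler_pdivrMr // mul1r.
- by move=> i j -> ->.
- by rewrite bigcup_set1 capE imA.
Qed.

Lemma le_contact_length : ((w + e)%:E <= rho 0 ((w + e) / P) (rescale f P))%E.
Proof.
have [P0 _] := length_gt0.
have s0 : 0 <= (w + e) / P.
  by move: adm => [/andP[w0 _] _ _ /andP[e0 _] _]; rewrite divr_ge0 ?(ltW P0) //; lra.
apply: le_trans (l1dist_le_rho (rescale f P) (s := 0) (t := (w + e) / P) _ _);
  rewrite ?lexx ?s0 //.
rewrite lee_fin /l1dist /rescale mulr0 mulrCA divff ?gt_eqF // mulr1.
move: adm => [/andP[w0 wW] k0 h0 /andP[e0 eh] we].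
by rewrite /notched_path /=; clamps; rewrite !ger0_norm; lra.
Qed.

Theorem rhoDB_shapes : exists2 v, is_rhoDB A B v & v <= 2 * W + 2 * k + e + w + 2 * h.
Proof.
have [blA rA] := boundary_notched; have [blB rB] := boundary_box.
have cap := contact_cap; have cl := le_contact_length.
have [P0 _] := length_gt0.
have [s0 s1] : 0 <= (w + e) / P /\ (w + e) / P <= 1.
  rewrite ler_pdivrMr // mul1r.
  move: adm => [/andP[w0 wW] k0 h0 /andP[e0 eh] we]; split.
    by rewrite divr_ge0 ?(ltW P0) //; lra.
  by rewrite /notched_length; lra.
move: cap cl; set c := rho 0 ((w + e) / P) _ => cap cl.
have cA : (c <= rho 0 1 (rescale f P))%E by exact: le_rho.
have fA : rho 0 1 (rescale f P) \is a fin_num.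
  by rewrite ge0_fin_numE ?rho_ge0 //; apply: le_lt_trans rA _; rewrite ltry.
have fB : rho 0 1 (rescale g Q) \is a fin_num.
  by rewrite ge0_fin_numE ?rho_ge0 //; apply: le_lt_trans rB _; rewrite ltry.
have fc : c \is a fin_num.
  by rewrite ge0_fin_numE ?rho_ge0 //; apply: le_lt_trans cA _; apply: le_lt_trans rA _; rewrite ltry.
exists (fine (rho 0 1 (rescale f P)) + fine (rho 0 1 (rescale g Q)) - fine c).
  exists (rescale f P), (rescale g Q), c; split => //.
  by rewrite EFinB EFinD !fineK.
have := fine_le fA _ rA; have := fine_le fB _ rB; have := fine_le _ fc cl.
move=> /(_ isT) /= h1 /(_ isT) /= h2 /(_ isT) /= h3.
rewrite /notched_length /box_length in h1 h2 h3 *; lra.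
Qed.

End ShapesPerimeter.

(** * The minimal perimeter *)

Section MinDB.
Context {R : realType}.

(** The parameters of the three competitors: e = 0 with equal widths for the
    stack, e = 0 for the rectangle on a side, and e = h for the corner. *)
Lemma optimal_shape (al : R) : 0 < al -> al < 1 -> exists W k w h e : R,
  [/\ admissible W k w h e, W * k + (W - w) * e = 1, w * h = al &
      2 * W + 2 * k + e + w + 2 * h = min_perim al].
Proof.
move=> al0 al1; rewrite /min_perim.
have [al2|al2] := leP al (1 / 2); last first.
  have [w [w0 wE ->]] := stack_perimE al0.
  have w1 : w != 0 by rewrite gt_eqF.
  exists w, (1 / w), w, (al / w), 0; split.
  - by split; rewrite ?w0 ?lexx ?divr_gt0 // ?divr_ge0 ?(ltW w0) ?(ltW al0) //; right.
  - by rewrite mulr0 addr0 mulrCA divff // mulr1.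
  - by rewrite mulrC divfK.
  - have -> : 2 * w + 2 * (1 / w) + 0 + w + 2 * (al / w) = (3 * w ^+ 2 + 2 * (1 + al)) / w.
      by field.
    by rewrite -wE; field.
have [cs|sc] := leP (corner_perim al) (side_perim al).
- rewrite /corner_perim.
  have a1 : (0 : R) <= 1 + al by lra.
  have := sqr_sqrtr a1; have := sqr_sqrtr (ltW al0).
  have : Num.sqrt al < Num.sqrt (1 + al) by rewrite ltr_sqrt; lra.
  have : 0 < Num.sqrt al by rewrite sqrtr_gt0.
  move: (Num.sqrt al) (Num.sqrt (1 + al)) => s t s0 st sE tE.
  exists t, (t - s), s, s, s; split.
  - by split; rewrite ?s0 ?lexx ?(ltW st) ?(ltW s0) ?subr_gt0 //; left.
  - by move: sE tE; rewrite !expr2 => sE tE; lra.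
  - by rewrite -sE expr2.
  - by lra.
- rewrite /side_perim.
  have a1 : (0 : R) <= 2 * al by lra.
  have := sqr_sqrtr a1; have : 0 < Num.sqrt (2 * al) by rewrite sqrtr_gt0; lra.
  have : Num.sqrt (2 * al) <= 1 by rewrite -[leRHS](@sqrtr1 R); apply: ler_wsqrtr; lra.
  move: (Num.sqrt _) => s s1 s0 sE; rewrite expr2 in sE.
  exists 1, 1, s, (s / 2), 0; split.
  - by split; rewrite ?s0 ?s1 ?lexx ?ltr01 // ?divr_gt0 // ?divr_ge0 ?(ltW s0) //; right.
  - by rewrite mulr0 addr0 mulr1.
  - by lra.
  - by lra.
Qed.

Theorem minDBE (al : R) : 0 < al -> al < 1 -> minDB al = min_perim al.
Proof.
move=> al0 al1; rewrite /minDB; set S := [set v | _].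
have lb : lbound S (min_perim al).
  by move=> v [A [B [gAB rv]]]; exact: (min_perim_le_rhoDB al0 (ltW al1) gAB rv).
have [W [k [w [h [e [adm aA aB pE]]]]]] := optimal_shape al0 al1.
have [v rv vle] := rhoDB_shapes adm.
have Sv : S v by exists (notched W k w e), (box w h); split => //; exact: gamma_shapes.
apply/eqP; rewrite eq_le; apply/andP; split.
  rewrite -pE; apply: le_trans vle; apply: ge_inf => //.
  by exists (min_perim al).
by apply: lb_le_inf => //; exists v.
Qed.

End MinDB.

(** * Derivatives of combinations of square roots *)

Section SqrtDerivatives.
Context {R : realType}.
Implicit Types (x a b c : R) (k : nat).

(** The derivatives of the square root are multiples of these functions. The
    form x^-1 ^+ k * sqrt x makes the recursion on k a product rule. *)
Definition sqrt_over k x : R := x^-1 ^+ k * Num.sqrt x.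

Lemma is_derive_sqrt_over k x : 0 < x ->
  is_derive x 1 (sqrt_over k) ((1 / 2 - k%:R) * sqrt_over k.+1 x).
Proof.
move=> x0; have s0 : Num.sqrt x != 0 by rewrite gt_eqF // sqrtr_gt0.
have xE : x = Num.sqrt x * Num.sqrt x by rewrite -expr2 sqr_sqrtr // ltW.
elim: k => [|k IH].
  have -> : sqrt_over 0 = Num.sqrt.
    by apply/funext => y; rewrite /sqrt_over expr0 mul1r.
  apply: is_derive_eq (is_derive1_sqrt x0) _.
  rewrite /sqrt_over expr1 {2}xE; field.
  by rewrite s0.
have -> : sqrt_over k.+1 = (fun y : R => y^-1) * sqrt_over k.
  by apply/funext => y; rewrite /sqrt_over exprS -mulrA.
have dV : is_derive x 1 (fun y : R => y^-1) (- x ^- 2 *: 1).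
  by apply: (@is_deriveV _ id); rewrite ?gt_eqF.
apply: is_derive_eq (is_deriveM dV IH) _.
rewrite /sqrt_over /GRing.scale /= -natr1 !exprS; field.
by rewrite gt_eqF.
Qed.

Definition half_falling k : R := \prod_(i < k) (1 / 2 - i%:R).

(** The k-th derivative of x |-> c0 + c1 sqrt x + c2 sqrt (1 + x). *)
Definition sqrt_comb_derive (c0 c1 c2 : R) k x : R :=
  (if k == 0%N then c0 else 0) +
  half_falling k * (c1 * sqrt_over k x + c2 * sqrt_over k (1 + x)).

Lemma sqrt_comb_derive0 c0 c1 c2 x :
  sqrt_comb_derive c0 c1 c2 0 x = c0 + (c1 * Num.sqrt x + c2 * Num.sqrt (1 + x)).
Proof. by rewrite /sqrt_comb_derive /half_falling big_ord0 /sqrt_over !expr0 !mul1r. Qed.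

Lemma is_derive_sqrt_comb c0 c1 c2 k x : 0 < x ->
  is_derive x 1 (sqrt_comb_derive c0 c1 c2 k) (sqrt_comb_derive c0 c1 c2 k.+1 x).
Proof.
move=> x0; have x1 : 0 < 1 + x by lra.
have d1 := is_derive_sqrt_over k x0.
have d2 : is_derive x 1 (fun y => sqrt_over k (1 + y))
    ((1 / 2 - k%:R) * sqrt_over k.+1 (1 + x) * 1).
  apply: (@is_derive1_comp _ (sqrt_over k) (fun y => 1 + y)).
    exact: is_derive_sqrt_over.
  have -> : (fun y : R => 1 + y) = cst 1 + id by [].
  by apply: is_derive_eq; rewrite add0r.
have -> : sqrt_comb_derive c0 c1 c2 k = cst (if k == 0%N then c0 else 0) +
    half_falling k \*: (c1 \*: sqrt_over k + c2 \*: (fun y => sqrt_over k (1 + y))).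
  by apply/funext.
apply: is_derive_eq (is_deriveD (is_derive_cst _ _ _)
  (is_deriveZ _ (is_deriveD (is_deriveZ _ d1) (is_deriveZ _ d2)))) _.
rewrite /sqrt_comb_derive /half_falling big_ord_recr /= /GRing.scale /=; ring.
Qed.

(** Derivatives are local, so agreement on an open interval propagates to all
    derivatives. *)
Lemma derive1n_sqrt_comb (m : R -> R) c0 c1 c2 a b : 0 <= a ->
  (forall x, a < x < b -> m x = sqrt_comb_derive c0 c1 c2 0 x) ->
  forall k x, a < x < b -> derive1n k m x = sqrt_comb_derive c0 c1 c2 k x /\
    derivable (derive1n k m) x 1.
Proof.
move=> a0 mE.
have nearab (x : R) : a < x < b -> \forall y \near x, a < y < b.
  move=> xab; have := @near_in_itvoo R a b x; rewrite !in_itv /=.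
  by move=> /(_ xab); apply: filterS => y; rewrite in_itv.
have step k : (forall x, a < x < b -> derive1n k m x = sqrt_comb_derive c0 c1 c2 k x) ->
    forall x, a < x < b -> is_derive x 1 (derive1n k m) (sqrt_comb_derive c0 c1 c2 k.+1 x).
  move=> h x xab; have x0 : 0 < x by lra.
  apply: near_eq_is_derive (is_derive_sqrt_comb c0 c1 c2 k x0).
  by apply: filterS (nearab x xab) => y /h ->.
have all k : forall x, a < x < b -> derive1n k m x = sqrt_comb_derive c0 c1 c2 k x.
  elim: k => [|k IH] x xab; first exact: mE.
  by rewrite derive1nS derive1E; have [_ ->] := step k IH x xab.
move=> k x xab; split; first exact: all.
by have [] := step k (all k) x xab.
Qed.

Lemma sqrt_comb_continuous c0 c1 c2 k x : 0 < x ->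
  {for x, continuous (sqrt_comb_derive c0 c1 c2 k)}.
Proof.
move=> x0; apply: differentiable_continuous; apply/derivable1_diffP.
by have [] := is_derive_sqrt_comb c0 c1 c2 k x0.
Qed.

Lemma derive1n_cvg_left (m : R -> R) c0 c1 c2 a b : 0 <= a -> a < b ->
  (forall x, a < x < b -> m x = sqrt_comb_derive c0 c1 c2 0 x) ->
  forall k p, a < p <= b ->
  derive1n k m x @[x --> p^'-] --> sqrt_comb_derive c0 c1 c2 k p.
Proof.
move=> a0 ab mE k p /andP[ap pb].
have p0 : 0 < p by lra.
have : sqrt_comb_derive c0 c1 c2 k x @[x --> p^'-] --> sqrt_comb_derive c0 c1 c2 k p.
  by apply: cvg_at_left_filter; exact: sqrt_comb_continuous.
apply: cvg_trans; apply: near_eq_cvg.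
near=> x; have xab : a < x < b.
  apply/andP; split; first by near: x; exact: nbhs_left_gt.
  by apply: lt_le_trans pb; near: x; exact: nbhs_left_lt.
by have [-> _] := derive1n_sqrt_comb a0 mE k xab.
Unshelve. all: by end_near. Qed.

Lemma derive1n_cvg_right (m : R -> R) c0 c1 c2 a b : 0 <= a -> a < b ->
  (forall x, a < x < b -> m x = sqrt_comb_derive c0 c1 c2 0 x) ->
  forall k p, 0 < p -> a <= p < b ->
  derive1n k m x @[x --> p^'+] --> sqrt_comb_derive c0 c1 c2 k p.
Proof.
move=> a0 ab mE k p p0 /andP[ap pb].
have : sqrt_comb_derive c0 c1 c2 k x @[x --> p^'+] --> sqrt_comb_derive c0 c1 c2 k p.
  by apply: cvg_at_right_filter; exact: sqrt_comb_continuous.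
apply: cvg_trans; apply: near_eq_cvg.
near=> x; have xab : a < x < b.
  apply/andP; split; last by near: x; exact: nbhs_right_lt.
  by apply: (le_lt_trans ap); near: x; exact: nbhs_right_gt.
by have [-> _] := derive1n_sqrt_comb a0 mE k xab.
Unshelve. all: by end_near. Qed.

Lemma no_phase_transition (m : R -> R) c0 c1 c2 a b : 0 <= a ->
  (forall x, a < x < b -> m x = sqrt_comb_derive c0 c1 c2 0 x) ->
  forall p, a < p < b -> ~ phase_transition m p.
Proof.
move=> a0 mE p /andP[ap pb] [k [_ [_ [y [z [ly lz yz]]]]]]; apply: yz.
have ab : a < b by lra.
have p0 : 0 < p by lra.
have pl : a < p <= b by rewrite ap ltW.
have pr : a <= p < b by rewrite pb ltW.
rewrite (cvg_unique _ ly (derive1n_cvg_left a0 ab mE (k := k) pl)) //.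
by rewrite (cvg_unique _ lz (derive1n_cvg_right a0 ab mE (k := k) p0 pr)).
Qed.

Lemma deriv_jump_sqrt_comb (m : R -> R) c0 c1 c2 c0' c1' c2' a p b k :
  0 <= a -> a < p -> p < b ->
  (forall x, a < x < p -> m x = sqrt_comb_derive c0 c1 c2 0 x) ->
  (forall x, p < x < b -> m x = sqrt_comb_derive c0' c1' c2' 0 x) ->
  sqrt_comb_derive c0 c1 c2 k p <> sqrt_comb_derive c0' c1' c2' k p ->
  deriv_jump m k p.
Proof.
move=> a0 ap pb mE mE' jump; have p0 : 0 < p by lra.
split; last first.
  exists (sqrt_comb_derive c0 c1 c2 k p), (sqrt_comb_derive c0' c1' c2' k p); split => //.
    by apply: (derive1n_cvg_left a0 ap mE); rewrite ap lexx.
  by apply: (derive1n_cvg_right (ltW p0) pb mE'); rewrite ?lexx.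
have nearab : \forall x \near p, a < x < b.
  have := @near_in_itvoo R a b p; rewrite !in_itv /= ap pb => /(_ isT).
  by apply: filterS => y; rewrite in_itv.
apply: filterS nearab => x xab xp j _.
have [xltp|xgtp|xE] := ltgtP x p.
- have xap : a < x < p by lra.
  by have [] := derive1n_sqrt_comb a0 mE j xap.
- have xpb : p < x < b by lra.
  by have [] := derive1n_sqrt_comb (ltW p0) mE' j xpb.
- by rewrite xE eqxx in xp.
Qed.

End SqrtDerivatives.

(** * The two transitions *)

Section Transitions.
Context {R : realType}.
Local Notation r := (Num.sqrt 2%:R : R).
Local Notation al0 := ((688%:R - 480%:R * r) / 49%:R).

Lemma sqrt2_bounds : [/\ r * r = 2, 14 / 10 < r & r < 142 / 100].
Proof.
have r2 : r ^+ 2 = 2 by rewrite sqr_sqrtr.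
have r0 : 0 <= r by exact: sqrtr_ge0.
rewrite expr2 in r2; split => //; rewrite ltNge; apply/negP => h; nra.
Qed.

Lemma critical_bounds : 0 < al0 /\ al0 < 1 / 2.
Proof. by have [r2 r3 r4] := sqrt2_bounds; split; lra. Qed.

(** With s = sqrt al and r = sqrt 2, the two lengths 4 sqrt (1 + s^2) + 2 s and
    4 + 2 r s are equal for s = 4 (r - 1) / (1 + 2 r), whose square is the critical
    value. *)
Lemma corner_le_side (al : R) : 0 < al ->
  (corner_perim al <= side_perim al) = (al <= al0).
Proof.
move=> a0; have [r2 r3 r4] := sqrt2_bounds.
have s0 := sqrtr_ge0 al; have sE := sqr_sqrtr (ltW a0).
have t0 := sqrtr_ge0 (1 + al); have tE : Num.sqrt (1 + al) ^+ 2 = 1 + al.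
  by rewrite sqr_sqrtr //; lra.
rewrite /corner_perim /side_perim sqrtrM //.
move: (Num.sqrt al) (Num.sqrt (1 + al)) s0 sE t0 tE => s t s0 sE t0 tE.
have -> : (4 * t + 2 * s <= 4 + 2 * (r * s)) = (2 * t <= 2 + (r - 1) * s).
  by apply/idP/idP => ?; lra.
rewrite -[LHS](@ler_pXn2r _ 2) ?nnegrE //; [|lra|nra].
have -> : ((2 * t) ^+ 2 <= (2 + (r - 1) * s) ^+ 2) =
    (s * (s * (1 + 2 * r)) <= s * (4 * (r - 1))).
  have -> : (2 * t) ^+ 2 = 4 + 4 * s ^+ 2 by rewrite exprMn tE -sE; ring.
  have -> : (2 + (r - 1) * s) ^+ 2 = 4 + 4 * (r - 1) * s + (r * r - 2 * r + 1) * s ^+ 2 by ring.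
  by rewrite r2 expr2; apply/idP/idP => ?; lra.
have sp : 0 < s by rewrite lt_neqAle s0 andbT; apply/eqP => sz; move: a0; rewrite -sE -sz expr0n /= ltxx.
rewrite ler_pM2l // -[LHS](@ler_pXn2r _ 2) ?nnegrE //; [|nra|lra].
have -> : (s * (1 + 2 * r)) ^+ 2 = al * (9 + 4 * r).
  by rewrite exprMn sE; have -> : (1 + 2 * r) ^+ 2 = 1 + 4 * r + 4 * (r * r) by [ring]; rewrite r2; ring.
have -> : (4 * (r - 1)) ^+ 2 = 48 - 32 * r.
  have -> : (4 * (r - 1)) ^+ 2 = 16 * (r * r) - 32 * r + 16 by ring.
  by rewrite r2; ring.
have k0 : 0 < 9 + 4 * r by lra.
rewrite -ler_pdivlMr //.
congr (_ <= _); apply: (mulIf (lt0r_neq0 k0)); rewrite divfK ?gt_eqF //.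
have -> : al0 * (9 + 4 * r) = (6192 - 1568 * r - 1920 * (r * r)) / 49 by field.
by rewrite r2; field.
Qed.

Lemma minDB_corner (x : R) : 0 < x < al0 ->
  minDB x = sqrt_comb_derive 0 2 4 0 x.
Proof.
move=> /andP[x0 xa]; have [_ a2] := critical_bounds.
rewrite minDBE //; last lra.
rewrite /min_perim ifT; last lra.
rewrite sqrt_comb_derive0 min_l; last by rewrite corner_le_side // ltW.
by rewrite /corner_perim add0r addrC.
Qed.

Lemma minDB_side (x : R) : al0 < x < 1 / 2 ->
  minDB x = sqrt_comb_derive 4 (2 * r) 0 0 x.
Proof.
move=> /andP[x0 xa]; have [a1 a2] := critical_bounds.
rewrite minDBE; [|lra|lra].
rewrite /min_perim ifT; last lra.
rewrite sqrt_comb_derive0 min_r; last first.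
  by rewrite leNgt; apply/negP => /ltW; rewrite corner_le_side //; lra.
by rewrite /side_perim sqrtrM // mul0r addr0 mulrA.
Qed.

Lemma minDB_stack (x : R) : 1 / 2 < x < 1 ->
  minDB x = sqrt_comb_derive 0 0 (2 * Num.sqrt 6) 0 x.
Proof.
move=> /andP[x0 xa].
rewrite minDBE; [|lra|lra].
rewrite /min_perim ifF; last by apply/negbTE; rewrite -ltNge.
by rewrite sqrt_comb_derive0 /stack_perim sqrtrM // mul0r !add0r mulrA.
Qed.

Lemma sqrt_over_sq k (x : R) : 0 < x -> sqrt_over k x ^+ 2 * x ^+ (2 * k) = x.
Proof.
move=> x0; rewrite /sqrt_over exprMn sqr_sqrtr ?(ltW x0) // -exprM mulnC.
by rewrite mulrAC -exprMn mulVf ?gt_eqF // expr1n mul1r.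
Qed.

Lemma sqrt_over_gt0 k (x : R) : 0 < x -> 0 < sqrt_over k x.
Proof. by move=> x0; rewrite mulr_gt0 ?sqrtr_gt0 // exprn_gt0 // invr_gt0. Qed.

(** Equality of the slopes would force 4 al = (r - 1)^2 (1 + al) at the critical
    value, with r = sqrt 2. *)
Lemma corner_side_jump : deriv_jump (@minDB R) 1 al0.
Proof.
have [a1 a2] := critical_bounds; have [r2 r3 r4] := sqrt2_bounds.
apply: (deriv_jump_sqrt_comb (lexx 0) a1 a2 minDB_corner minDB_side).
rewrite /sqrt_comb_derive /half_falling big_ord1 /=.
have := sqrt_over_sq 1 a1; have := sqrt_over_gt0 1 a1.
have a3 : 0 < 1 + al0 by lra.
have := sqrt_over_sq 1 a3; have := sqrt_over_gt0 1 a3.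
rewrite muln1.
move: (sqrt_over 1 al0) (sqrt_over 1 (1 + al0)) => p q q0 qE p0 pE eq.
have e1 : 2 * q = (r - 1) * p by lra.
have pE' : p ^+ 2 * al0 = 1.
  by apply: (mulIf (lt0r_neq0 a1)); rewrite -mulrA -expr2 pE mul1r.
have qE' : q ^+ 2 * (1 + al0) = 1.
  by apply: (mulIf (lt0r_neq0 a3)); rewrite -mulrA -expr2 qE mul1r.
(* 4 al0 = (r - 1)^2 (1 + al0), which fails *)
have : 4 * al0 = (3 - 2 * r) * (1 + al0).
  have e2 : 4 * q ^+ 2 = (3 - 2 * r) * p ^+ 2.
    have -> : 4 * q ^+ 2 = (2 * q) ^+ 2 by ring.
    rewrite e1; have -> : ((r - 1) * p) ^+ 2 = (r * r - 2 * r + 1) * p ^+ 2 by ring.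
    by rewrite r2; ring.
  have : 4 * q ^+ 2 * (1 + al0) * al0 = (3 - 2 * r) * p ^+ 2 * al0 * (1 + al0).
    by rewrite e2; ring.
  rewrite -[4 * _ * _]mulrA qE' -[_ * p ^+ 2 * _]mulrA pE'; lra.
move=> h; have : 4 * (688 - 480 * r) = (3 - 2 * r) * (737 - 480 * r).
  lra.
have -> : (3 - 2 * r) * (737 - 480 * r) = 2211 - 2914 * r + 960 * (r * r) by ring.
rewrite r2; lra.
Qed.

(** The second derivatives at 1 / 2 are -2 and -2 / 3. *)
Lemma side_stack_jump : deriv_jump (@minDB R) 2 (1 / 2%:R).
Proof.
have [a1 a2] := critical_bounds; have [r2 r3 r4] := sqrt2_bounds.
have h1 : (1 / 2 : R) < 1 by lra.
apply: (deriv_jump_sqrt_comb (ltW a1) a2 h1 minDB_side minDB_stack).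
rewrite /sqrt_comb_derive /half_falling !big_ord_recr big_ord0 /=.
have x0 : 0 < (1 / 2 : R) by lra.
have y0 : 0 < (1 + 1 / 2 : R) by lra.
have := sqrt_over_sq 2 x0; have := sqrt_over_gt0 2 x0.
have := sqrt_over_sq 2 y0; have := sqrt_over_gt0 2 y0.
move: (sqrt_over 2 (1 / 2)) (sqrt_over 2 (1 + 1 / 2)) => p q q0 qE p0 pE eq.
have s6 : Num.sqrt 6 ^+ 2 = 6 :> R by rewrite sqr_sqrtr.
have e1 : r * p = Num.sqrt 6 * q by lra.
have e2 : 2 * p ^+ 2 = 6 * q ^+ 2.
  by rewrite -{1}r2 -s6 -exprMn -e1; ring.
have pE' : p ^+ 2 = 8.
  have -> : p ^+ 2 = 16 * (p ^+ 2 * (1 / 2) ^+ (2 * 2)) by field.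
  by rewrite pE; lra.
have qE' : q ^+ 2 = 8 / 27.
  have -> : q ^+ 2 = 16 / 81 * (q ^+ 2 * (1 + 1 / 2) ^+ (2 * 2)) by field.
  by rewrite qE; field.
by move: e2; rewrite pE' qE'; lra.
Qed.

Lemma phase_transitionP (a : R) : 0 < a < 1 ->
  (phase_transition (@minDB R) a <-> a = al0 \/ a = 1 / 2%:R).
Proof.
move=> /andP[a0 a1]; have [b1 b2] := critical_bounds.
split; last first.
  move=> [->|->]; [exists 1%N|exists 2%N]; split => //.
    exact: corner_side_jump.
  exact: side_stack_jump.
move=> pt; have [h|h|->] := ltgtP a al0; last by left.
  by exfalso; apply: (no_phase_transition (lexx 0) minDB_corner _ pt); rewrite a0.
have [h'|h'|->] := ltgtP a (1 / 2); last by right.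
  by exfalso; apply: (no_phase_transition (ltW b1) minDB_side _ pt); rewrite h.
have h2 : (0 : R) <= 1 / 2 by lra.
by exfalso; apply: (no_phase_transition h2 minDB_stack _ pt); rewrite h'.
Qed.

End Transitions.

Theorem corollary1p1 (R : realType) :
  [/\ (forall a : R, 0 < a < 1 ->
        (phase_transition (@minDB R) a <->
         a = (688%:R - 480%:R * Num.sqrt 2%:R) / 49%:R \/ a = 1 / 2%:R)),
      deriv_jump (@minDB R) 1 ((688%:R - 480%:R * Num.sqrt 2%:R) / 49%:R) &
      deriv_jump (@minDB R) 2 (1 / 2%:R)].
Proof.
split.
- exact: phase_transitionP.
- exact: corner_side_jump.
- exact: side_stack_jump.
Qed.
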